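(* There is an algorithm which, given a cograph $G$ on $n$ vertices and an integer $k$, decides in time $O(n^3)$ whether the graph $TAR_k(G)$ is connected.
   Context: A graph is a cograph if it contains no induced path on four vertices. For a graph $G=(V,E)$ and an integer $k$, a $k$-independent set of $G$ is an independent set $S\subseteq V$ with $|S|\ge k$. Two $k$-independent sets $I,J$ are adjacent if they differ on exactly one vertex, i.e. there is a vertex $u$ with $I=J\cup\{u\}$ or $J=I\cup\{u\}$. The $k$-TAR-reconfiguration graph $TAR_k(G)$ is the graph whose vertices are the $k$-independent sets of $G$, with this adjacency. *)

(* Defs.v *)
From mathcomp Require Import all_boot all_order all_algebra.
Set Implicit Arguments. Unset Strict Implicit. Unset Printing Implicit Defensive.
Import GRing.Theory Num.Theory.

Definition simple_graph (n : nat) (E : rel 'I_n) : Prop :=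
  symmetric E /\ irreflexive E.

Definition cograph (n : nat) (E : rel 'I_n) : Prop :=
  forall a b c d : 'I_n,
    uniq [:: a; b; c; d] ->
    ~ [/\ E a b, E b c, E c d & [&& ~~ E a c, ~~ E b d & ~~ E a d]].

Definition independent (n : nat) (E : rel 'I_n) (S : {set 'I_n}) : bool :=
  [forall x in S, forall y in S, ~~ E x y].

Definition k_indep (n : nat) (E : rel 'I_n) (k : int) (S : {set 'I_n}) : bool :=
  independent E S && (k <= (#|S|)%:Z)%R.

Definition tar_adj (n : nat) (I J : {set 'I_n}) : bool :=
  [exists u, (I == u |: J) && (u \notin J)] ||
  [exists u, (J == u |: I) && (u \notin I)].

Definition TAR_rel (n : nat) (E : rel 'I_n) (k : int) : rel {set 'I_n} :=
  fun I J => [&& k_indep E k I, k_indep E k J & tar_adj I J].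

Definition TAR_connected (n : nat) (E : rel 'I_n) (k : int) : bool :=
  [forall I, forall J, (k_indep E k I && k_indep E k J) ==>
                       connect (TAR_rel E k) I J].

Inductive instr : Type :=
| IConst of nat & nat
| IAdd of nat & nat & nat
| ISub of nat & nat & nat
| IRead of nat & nat
| IWrite of nat & nat
| IJz of nat & nat
| IHalt.

Definition program := seq instr.
Definition memory := nat -> nat.
Definition config : Type := (nat * memory)%type.

Definition upd (m : memory) (a v : nat) : memory :=
  fun x => if x == a then v else m x.

Definition step (p : program) (c : config) : config :=
  let: (pc, m) := c in
  match nth IHalt p pc with
  | IConst d v => (pc.+1, upd m d v)
  | IAdd d a b => (pc.+1, upd m d (m a + m b))
  | ISub d a b => (pc.+1, upd m d (m a - m b))
  | IRead d a => (pc.+1, upd m d (m (m a)))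
  | IWrite a s => (pc.+1, upd m (m a) (m s))
  | IJz r l => (if m r == 0 then l else pc.+1, m)
  | IHalt => (pc, m)
  end.

Definition halted (p : program) (c : config) : bool :=
  if nth IHalt p c.1 is IHalt then true else false.

Definition run (p : program) (t : nat) (c : config) : config := iter t (step p) c.

Definition adjb (n : nat) (E : rel 'I_n) (i j : nat) : bool :=
  match @insub _ (fun x => x < n) 'I_n i, @insub _ (fun x => x < n) 'I_n j with
  | Some x, Some y => E x y
  | _, _ => false
  end.

(* Input encoding: M[0] = n, M[1] = [k >= 0], M[2] = |k|,
   M[3 + i*n + j] = adjacency bit of (i, j) for i, j < n, all else 0. *)
Definition init_mem (n : nat) (E : rel 'I_n) (k : int) : memory :=
  fun a =>
    if a == 0 then n
    else if a == 1 then nat_of_bool (0 <= k)%R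
    else if a == 2 then `|k|%N
    else if (3 <= a) && (a < 3 + n * n)
         then nat_of_bool (adjb E ((a - 3) %/ n) ((a - 3) %% n))
    else 0.

Definition decides_within (p : program) (n : nat) (E : rel 'I_n) (k : int)
    (b : bool) (t : nat) : Prop :=
  let c := run p t (0, init_mem E k) in
  halted p c /\ c.2 0 = nat_of_bool b.

(* Main.v *)
(** A cograph with at least two vertices has a pair of twins, and merging the two
    modules they stand for is a disjoint union or a join. For every module [V] we
    keep its independence number [a], the largest level [q] at which all maximum
    independent sets of [V] are linked, and for every size [s] the least level
    [m s] at which some independent set of size [s] is stuck, i.e. cannot reach a
    larger one. Since every set reaches a stuck one, TAR_k is connected iff
    [a < k], or [k <= q] and [k < m s] whenever [k <= s < a].

    At positive levels an independent set of a join stays in one part, so there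
    [m] is a pointwise minimum. In a disjoint union, [I1 :|: I2] is stuck at level
    [l] iff [I1] is stuck at [l - #|I2|] and [I2] at [l - #|I1|]: as long as neither
    side can grow, neither can lend more room to the other. Hence [m] becomes a
    min-max convolution, computed in O(n^2).

    Twins are found in O(n^2) per round by maintaining, for every pair, the number
    of active vertices on which the two rows differ. All loops are bounded by [n],
    [n + 1] or [n - 1] and are nested at most three deep, hence O(n^3). *)

(* The tables rest on monotonicity in the level: lowering it keeps sets linked ([linked_le]),
   raising it keeps a set stuck as long as the set itself stays admissible ([stuck_le]). So one
   threshold [q], and one threshold [m s] per size, carry the information for all levels. Level 0 is
   special: there the empty set links everything, so exactly the maximum sets are stuck, which the
   description of joins by their two parts misses and the tables must correct. Levels are natural
   numbers, and truncated subtraction yields the right level for one part when the other part alone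
   already meets the bound.

   The machine has only addition, truncated subtraction, indirect access and a jump on zero. The
   algorithm is therefore verified in a small loop language, and its compiler bounds the time by a
   constant times a power whose exponent is the nesting depth of the loops. The remaining obstacle
   is the dense input: any cell with a fixed address from 3 on may hold a matrix entry, so scratch
   space has to be gained before the matrix can be moved into the layout of the compiled code. *)
Require Import Defs.
From mathcomp Require Import all_boot all_order all_algebra zify.
Set Implicit Arguments. Unset Strict Implicit. Unset Printing Implicit Defensive.

(** * Reconfiguration in unions and joins *)

Section Reconfiguration.
Variables (n : nat) (E : rel 'I_n).
Hypotheses (Esym : symmetric E) (Eirr : irreflexive E).
Implicit Types (V I J M : {set 'I_n}) (l s : nat).

Definition indep_in V I := (I \subset V) && independent E I.
Definition tok V l I := indep_in V I && (l <= #|I|).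
Definition trel V l : rel {set 'I_n} :=
  fun I J => [&& tok V l I, tok V l J & tar_adj I J].
(** The conjunct [tok] matters only for the empty path: [connect] relates every set to itself, even
    one below the level. *)
Definition linked V l I J := tok V l I && connect (trel V l) I J.
Definition stuck V l I :=
  tok V l I && [forall J, connect (trel V l) I J ==> (#|J| <= #|I|)].

Lemma tar_adj_sym I J : tar_adj I J = tar_adj J I.
Proof. by rewrite /tar_adj orbC. Qed.

Lemma trel_sym V l : connect_sym (trel V l).
Proof. by apply: sym_connect_sym => I J; rewrite /trel tar_adj_sym andbCA. Qed.

Lemma linked_tok V l I J : linked V l I J -> tok V l J.
Proof.
case/andP => tI /connectP[p]; elim: p I tI => [I tI _ ->//|K p IH I tI] /=.
by case/andP => /and3P[_ tK _] pK eJ; apply: (IH K).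
Qed.

Lemma linked_refl V l I : tok V l I -> linked V l I I.
Proof. by rewrite /linked connect0 => ->. Qed.

Lemma linked_trans V l I J K : linked V l I J -> linked V l J K -> linked V l I K.
Proof.
by case/andP=> tI cIJ /andP[_ cJK]; rewrite /linked tI (connect_trans cIJ cJK).
Qed.

Lemma linked_sym V l I J : linked V l I J -> linked V l J I.
Proof.
move=> L; have tJ := linked_tok L; case/andP: L => tI cIJ.
by rewrite /linked tJ trel_sym.
Qed.

Lemma linked_ind V l I (P : {set 'I_n} -> Prop) : P I ->
  (forall J K, tok V l J -> tok V l K -> tar_adj J K ->
     linked V l I J -> P J -> P K) ->
  forall J, linked V l I J -> P J.
Proof.
move=> PI PS J /andP[tI /connectP[p]].
elim/last_ind: p J => [J _ ->//|p K IH J].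
rewrite rcons_path last_rcons => /andP[pp e] ->{J}.
have Hp := IH _ pp erefl; case/and3P: (e) => t1 t2 a.
apply: PS Hp => //; rewrite /linked tI; apply/connectP; by exists p.
Qed.

Lemma linked_step V l I J : tok V l I -> tok V l J -> tar_adj I J -> linked V l I J.
Proof. by move=> tI tJ a; rewrite /linked tI connect1 // /trel tI tJ. Qed.

Lemma stuckP V l I :
  reflect (tok V l I /\ forall J, linked V l I J -> #|J| <= #|I|) (stuck V l I).
Proof.
apply: (iffP andP) => [[tI /forallP H]|[tI H]]; split => //.
  by move=> J /andP[_ c]; apply: (implyP (H J)).
by apply/forallP => J; apply/implyP => c; apply: H; rewrite /linked tI.
Qed.

Lemma independentP I : reflect {in I &, forall x y, ~~ E x y} (independent E I).
Proof.
apply: (iffP forall_inP) => [H x y xI yI|H x xI].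
  by move/forall_inP: (H x xI); apply.
by apply/forall_inP => y yI; apply: H.
Qed.

Lemma independentS I J : I \subset J -> independent E J -> independent E I.
Proof.
move=> /subsetP sIJ /independentP H; apply/independentP => x y /sIJ xJ /sIJ.
exact: H.
Qed.

Lemma indep_inS V I J : I \subset J -> indep_in V J -> indep_in V I.
Proof.
by move=> sIJ /andP[sJ iJ]; rewrite /indep_in (subset_trans sIJ) ?(independentS sIJ).
Qed.

(** All sets between [J] and [I] have at least [#|J|] elements, so removing the vertices of
    [I :\: J] one at a time never falls below the level. *)
Lemma linked_sub V l I J : J \subset I -> tok V l I -> l <= #|J| -> linked V l I J.
Proof.
move: {2}#|I :\: J| (leqnn #|I :\: J|) => d.
elim: d I => [|d IH] I Hd sJI tI lJ.
  have sIJ : I \subset J by rewrite -setD_eq0 -cards_eq0 -leqn0.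
  have -> : J = I by apply/eqP; rewrite eqEsubset sJI.
  exact: linked_refl.
have [e0|[x xD]] := set_0Vmem (I :\: J).
  by apply: IH => //; rewrite e0 cards0.
have [xI xnJ] : x \in I /\ x \notin J by move: xD; rewrite !inE => /andP[-> ->].
have sJx : J \subset I :\ x by rewrite subsetD1 sJI.
have tIx : tok V l (I :\ x).
  case/andP: tI => iI _; rewrite /tok (indep_inS _ iI) ?subsetDl //=.
  by apply: leq_trans lJ _; apply: subset_leq_card.
apply: (@linked_trans _ _ _ (I :\ x)).
  apply: linked_step => //; apply/orP; left; apply/existsP; exists x.
  by rewrite setD1K // eqxx !inE eqxx.
apply: IH => //; rewrite -ltnS; apply: leq_trans Hd.
have -> : I :\ x :\: J = (I :\: J) :\ x by rewrite !setDDl setUC.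
by rewrite (cardsD1 x (I :\: J)) xD.
Qed.

Lemma linked0 V I J : indep_in V I -> indep_in V J -> linked V 0 I J.
Proof.
move=> iI iJ; apply: (@linked_trans _ _ _ set0).
  by apply: linked_sub; rewrite ?sub0set // /tok iI.
by apply/linked_sym/linked_sub; rewrite ?sub0set // /tok iJ.
Qed.

Lemma linked_le V l l' I J : l' <= l -> linked V l I J -> linked V l' I J.
Proof.
move=> le L; have [tI _] := andP L.
have w K : tok V l K -> tok V l' K.
  by case/andP=> iK lK; rewrite /tok iK (leq_trans le).
elim/(linked_ind (V := V) (l := l) (I := I)): J / L.
  by apply: linked_refl; apply: w.
move=> J K tJ tK a _ L; apply: linked_trans L _.
by apply: linked_step => //; apply: w.
Qed.

Definition alpha_spec V a :=
  (exists2 I, indep_in V I & #|I| = a) /\ forall I, indep_in V I -> #|I| <= a.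
(** By [linked_le] the good levels form an initial segment, so a single number describes them. *)
Definition merge_spec V a q := forall l, l <= a ->
  (l <= q) <-> (forall I J, indep_in V I -> indep_in V J -> #|I| = a -> #|J| = a ->
                linked V l I J).
(** By [stuck_le] the levels at which a set of size [s] is stuck are closed upwards, as far as [s].
    A value above [s] says that no set of this size is ever stuck, so any large number can serve as
    infinity. *)
Definition stuck_spec V (m : nat -> nat) := forall s l, l <= s -> s <= n ->
  (m s <= l) <-> (exists2 I, stuck V l I & #|I| = s).

Definition spec V a q m := [/\ alpha_spec V a, merge_spec V a q & stuck_spec V m].

Lemma spec_ext V a q m m' : (forall t, t <= n -> m t = m' t) ->
  spec V a q m -> spec V a q m'.
Proof.
by move=> mm' [Ha Hq Hm]; split=> // s l ls sn; rewrite -mm' // (Hm s l ls sn).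
Qed.

Lemma alpha_le_n V a : alpha_spec V a -> a <= n.
Proof. by move=> [[I _ <-] _]; rewrite -[n in _ <= n]card_ord max_card. Qed.

Lemma stuck_le V l l' I : l <= l' -> l' <= #|I| -> stuck V l I -> stuck V l' I.
Proof.
move=> le leI /stuckP[/andP[iI _] H]; apply/stuckP; split; first by rewrite /tok iI.
by move=> J /(linked_le le); apply: H.
Qed.

Lemma stuck0 V a I : alpha_spec V a -> stuck V 0 I <-> indep_in V I /\ #|I| = a.
Proof.
move=> [[M iM cM] maxa]; split.
  move=> /stuckP[/andP[iI _] H]; split => //; apply/eqP; rewrite eqn_leq maxa //=.
  by rewrite -cM; apply: H; apply: linked0.
case=> iI cI; apply/stuckP; split; first by rewrite /tok iI.
by move=> J /linked_tok/andP[iJ _]; rewrite cI maxa.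
Qed.

Lemma linked_stuck V l I : tok V l I -> exists2 J, linked V l I J & stuck V l J.
Proof.
move=> tI.
pose J := [arg max_(J > I | linked V l I J) #|J|].
have [LJ mJ] : linked V l I J /\ forall K, linked V l I K -> #|K| <= #|J|.
  by rewrite /J; case: arg_maxnP => [|K LK mK]; first exact: linked_refl.
exists J => //; apply/stuckP; split; first exact: linked_tok LJ.
by move=> K LK; apply: mJ; apply: linked_trans LK.
Qed.

(** A negative bound excludes no set, just like the bound 0. *)
Definition clamp (k : int) := if (0 <= k)%R then `|k|%N else 0.

Lemma TAR_connectedP k :
  reflect (forall I J, tok setT (clamp k) I -> tok setT (clamp k) J -> linked setT (clamp k) I J)
          (TAR_connected E k).
Proof.
set l := clamp k.
have tE I : k_indep E k I = tok setT l I.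
  rewrite /k_indep /tok /indep_in subsetT /=; congr (_ && _).
  by rewrite /l /clamp; case: ifP; lia.
have cE : TAR_rel E k =2 trel setT l by move=> I J; rewrite /TAR_rel /trel !tE.
apply: (iffP idP).
  move=> /forallP H I J tI tJ; have /forallP/(_ J) := H I.
  by rewrite !tE tI tJ /= (eq_connect cE) /linked tI.
move=> H; apply/forallP => I; apply/forallP => J; rewrite !tE.
by apply/implyP => /andP[tI tJ]; rewrite (eq_connect cE); case/andP: (H I J tI tJ).
Qed.

(** The test may run over all sizes other than [a] instead of those below [a]: a size above [a] has
    no independent set, so its [m s] exceeds every level up to [s]. *)
Lemma TAR_connected_spec k a q m (l := clamp k) : spec setT a q m ->
  TAR_connected E k =
  (a < l) || (l <= q) && [forall s : 'I_n.+1, (l <= s) ==> (s != a :> nat) ==> (l < m s)].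
Proof.
case=> Ha Hq Hm; have an := alpha_le_n Ha.
have [[M iM cM] maxa] := Ha.
apply/TAR_connectedP/orP; rewrite -/l.
- move=> H; case: (ltnP a l) => [|la]; [by left|right].
  apply/andP; split.
    apply/(Hq l la) => I J iI iJ cI cJ; apply: H; by rewrite /tok ?iI ?iJ ?cI ?cJ.
  apply/forallP => s; apply/implyP => ls; apply/implyP => nsa.
  rewrite ltnNge; apply/negP => /(Hm _ _ ls (ltn_ord s))[I /stuckP[tI st] cI].
  have tM : tok setT l M by rewrite /tok iM cM.
  have := st M (H I M tI tM); rewrite cI cM => as_.
  have := maxa I; rewrite cI; case/andP: tI => iI _ /(_ iI) sa.
  by rewrite eqn_leq as_ sa in nsa.
- case=> [al I J /andP[iI lI]|/andP[lq /forallP st] I J tI tJ].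
    by have := leq_trans al (leq_trans lI (maxa _ iI)); rewrite ltnn.
  (* Every set reaches a stuck one, which the condition on [m] forces to be maximum; maximum sets
     are linked to each other because [l <= q]. *)
  have top K : tok setT l K -> exists2 K', linked setT l K K' & indep_in setT K' /\ #|K'| = a.
    move=> /linked_stuck[K' LK sK']; exists K' => //.
    have /stuckP[/andP[iK' lK'] _] := sK'; split => //.
    have sn : #|K'| < n.+1 by rewrite ltnS; apply: leq_trans an; apply: maxa.
    apply/eqP; have /= := st (Ordinal sn); rewrite lK' /=.
    case: eqP => //= _; rewrite ltnNge => /negP[].
    by apply/(Hm _ _ lK' sn); exists K'.
  have [I' LI [iI' cI']] := top I tI; have [J' LJ [iJ' cJ']] := top J tJ.
  have la : l <= a by rewrite -cI'; case/andP: (linked_tok LI).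
  apply: linked_trans LI _; apply: linked_trans (linked_sym LJ).
  by apply: (proj1 (Hq l la) lq).
Qed.

(** The empty set is admissible only at level 0, where it can grow, so it is never stuck; the
    singleton is stuck from level 0 on. *)
Lemma spec1 x m : m 1 = 0 -> (forall s, s != 1 -> n < m s) -> spec [set x] 1 1 m.
Proof.
move=> m1 mS.
have ind1 I : indep_in [set x] I -> I = set0 \/ I = [set x].
  by case/andP; rewrite subset1 => /orP[]/eqP; [right|left].
have i1 : indep_in [set x] [set x].
  rewrite /indep_in subxx; apply/independentP => y z.
  by rewrite !inE => /eqP-> /eqP->; rewrite Eirr.
have Ha : alpha_spec [set x] 1.
  split; first by exists [set x]; rewrite ?cards1.
  by move=> I /ind1[]->; rewrite ?cards0 ?cards1.
split => //.
- move=> l l1; split => // _ I J iI iJ cI cJ.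
  case: (ind1 _ iI) cI => ->; rewrite ?cards0 // => _.
  case: (ind1 _ iJ) cJ => ->; rewrite ?cards0 // => _.
  by apply: linked_refl; rewrite /tok i1 cards1.
- move=> s l ls sn; case: (eqVneq s 1) ls => [-> l1|ns1 ls].
    rewrite m1; split => // _; exists [set x]; rewrite ?cards1 //.
    by apply: (stuck_le (leq0n l)); rewrite ?cards1 //; apply/(stuck0 _ Ha); rewrite cards1.
  split=> [H|[I sI cI]]; first by have := mS s ns1; lia.
  case/stuckP: (sI) => /andP[iI _] _.
  case: (ind1 _ iI) => eI; last by rewrite -cI eI cards1 in ns1.
  have l0 : l = 0 by move: ls; rewrite -cI eI cards0; lia.
  by move: sI; rewrite l0 => /(stuck0 _ Ha)[_]; rewrite eI cards0.
Qed.

(** * Disjoint unions without edges across *)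

Section Union.
Variables V1 V2 : {set 'I_n}.
Hypothesis dis : [disjoint V1 & V2].
Hypothesis nadj : forall x y, x \in V1 -> y \in V2 -> ~~ E x y.

Lemma capU1 I1 I2 : I1 \subset V1 -> I2 \subset V2 -> (I1 :|: I2) :&: V1 = I1.
Proof.
move=> s1 s2; rewrite setIUl (setIidPl s1); apply/setUidPl.
by rewrite (subset_trans (setSI _ s2)) // setIC (disjoint_setI0 dis) sub0set.
Qed.

Lemma cardU I1 I2 : I1 \subset V1 -> I2 \subset V2 -> #|I1 :|: I2| = #|I1| + #|I2|.
Proof.
move=> s1 s2; apply/eqP; rewrite leq_card_setU.
by apply: disjointWl s1 _; apply: disjointWr s2 _.
Qed.

Lemma indepU I1 I2 : indep_in V1 I1 -> indep_in V2 I2 -> indep_in (V1 :|: V2) (I1 :|: I2).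
Proof.
move=> /andP[s1 /independentP i1] /andP[s2 /independentP i2].
rewrite /indep_in setUSS //=; apply/independentP => x y.
rewrite !inE => /orP[]xI /orP[]yI.
- exact: i1.
- by apply: nadj; [apply: (subsetP s1)|apply: (subsetP s2)].
- by rewrite Esym; apply: nadj; [apply: (subsetP s1)|apply: (subsetP s2)].
- exact: i2.
Qed.

Lemma indepU_split I : indep_in (V1 :|: V2) I ->
  [/\ indep_in V1 (I :&: V1), indep_in V2 (I :&: V2) & I = (I :&: V1) :|: (I :&: V2)].
Proof.
move=> /andP[s i]; split.
- by rewrite /indep_in subsetIr (independentS _ i) ?subsetIl.
- by rewrite /indep_in subsetIr (independentS _ i) ?subsetIl.
- by rewrite -setIUr (setIidPl s).
Qed.

(** The vertex added or removed lies in exactly one part, so one projection makes a move and the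
    other rests. *)
Lemma tar_adj_cap I J : indep_in (V1 :|: V2) I -> indep_in (V1 :|: V2) J -> tar_adj I J ->
  (tar_adj (I :&: V1) (J :&: V1) /\ I :&: V2 = J :&: V2) \/
  (tar_adj (I :&: V2) (J :&: V2) /\ I :&: V1 = J :&: V1).
Proof.
have key A B u : indep_in (V1 :|: V2) A -> A = u |: B -> u \notin B ->
  (tar_adj (A :&: V1) (B :&: V1) /\ A :&: V2 = B :&: V2) \/
  (tar_adj (A :&: V2) (B :&: V2) /\ A :&: V1 = B :&: V1).
  move=> /andP[/subsetP s _] eA nu.
  have uV : u \in V1 :|: V2 by apply: s; rewrite eA !inE eqxx.
  have dj x : x \in V1 -> x \in V2 -> False.
    by move=> x1 x2; move/pred0P/(_ x): dis; rewrite /= x1 x2.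
  have one (W W' : {set 'I_n}) : u \in W -> u \notin W' ->
     tar_adj (A :&: W) (B :&: W) /\ A :&: W' = B :&: W'.
    move=> uW uW'; split.
      apply/orP; left; apply/existsP; exists u; rewrite inE (negPf nu) andbT.
      apply/eqP/setP => x; rewrite eA !inE.
      by case: eqP => [->|]; rewrite ?uW.
    apply/setP => x; rewrite eA !inE.
    by case: eqP => [->|]; rewrite ?(negPf uW') ?andbF.
  have [u1|u1] := boolP (u \in V1).
    by left; apply: one => //; apply/negP; apply: dj.
  by right; apply: one => //; move: uV; rewrite inE (negPf u1).
move=> iI iJ /orP[]/existsP[u /andP[/eqP e nu]].
  exact: (key _ _ u).
case: (key J I u iJ e nu) => [][a ->]; [left|right];
  by rewrite tar_adj_sym.
Qed.
End Union.

Lemma tar_adjU (I J K : {set 'I_n}) : tar_adj I J -> [disjoint I & K] -> [disjoint J & K] ->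
  tar_adj (I :|: K) (J :|: K).
Proof.
have key (A B : {set 'I_n}) u : A = u |: B -> u \notin B -> [disjoint A & K] ->
    (A :|: K == u |: (B :|: K)) && (u \notin B :|: K).
  move=> eA nu d; rewrite {1}eA setUA eqxx /= inE negb_or nu /=.
  apply/negP => uK; move/pred0P/(_ u): d; rewrite /= uK eA !inE eqxx.
  by [].
move=> a dI dJ.
case/orP: a => /existsP[u /andP[/eqP e nu]]; apply/orP; [left|right];
  by apply/existsP; exists u; apply: key.
Qed.
Lemma leq_add_eq x y a b : x + y = a + b -> x <= a -> y <= b -> x = a /\ y = b.
Proof. lia. Qed.

Definition sep V1 V2 := [disjoint V1 & V2] /\
  forall x y, x \in V1 -> y \in V2 -> ~~ E x y.

Lemma sep_sym V1 V2 : sep V1 V2 -> sep V2 V1.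
Proof.
by case=> d H; split; [rewrite disjoint_sym|move=> x y xV yV; rewrite Esym H].
Qed.

(** With [K] frozen on the other side, the moving part has to keep only [l - #|K|] vertices; the
    truncation to 0 is right when [K] alone meets the level. *)
Lemma linkedU V1 V2 l I1 J1 K : sep V1 V2 -> indep_in V2 K ->
  linked V1 (l - #|K|) I1 J1 -> linked (V1 :|: V2) l (I1 :|: K) (J1 :|: K).
Proof.
move=> [dis nadj] iK L; have sK : K \subset V2 by case/andP: iK.
have tokU I : tok V1 (l - #|K|) I -> tok (V1 :|: V2) l (I :|: K).
  move=> /andP[iI leI]; have sI : I \subset V1 by case/andP: iI.
  by rewrite /tok (indepU nadj iI iK) (cardU dis sI sK) addnC -leq_subLR.
have djK I : tok V1 (l - #|K|) I -> [disjoint I & K].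
  move=> /andP[/andP[sI _] _]; apply: disjointWl sI _; exact: disjointWr sK dis.
pose P J := linked (V1 :|: V2) l (I1 :|: K) (J :|: K).
apply: (linked_ind (P := P) _ _ L); rewrite /P.
  by apply/linked_refl/tokU; case/andP: L.
move=> J J' tJ tJ' a _ LJ; apply: linked_trans LJ _.
by apply: linked_step; rewrite ?tokU ?tar_adjU ?djK.
Qed.

Lemma stuckU V1 V2 l I1 I2 : sep V1 V2 -> indep_in V1 I1 -> indep_in V2 I2 ->
  l <= #|I1| + #|I2| ->
  stuck (V1 :|: V2) l (I1 :|: I2) <->
  stuck V1 (l - #|I2|) I1 /\ stuck V2 (l - #|I1|) I2.
Proof.
move=> sp i1 i2 lI; have [dis nadj] := sp.
have s1 : I1 \subset V1 by case/andP: i1.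
have s2 : I2 \subset V2 by case/andP: i2.
have t1 : tok V1 (l - #|I2|) I1 by rewrite /tok i1 leq_subLR addnC.
have t2 : tok V2 (l - #|I1|) I2 by rewrite /tok i2 leq_subLR.
have cI := cardU dis s1 s2.
split.
  move=> /stuckP[_ st]; split; apply/stuckP; split => // J LJ.
    have := st _ (linkedU sp i2 LJ).
    case/andP: (linked_tok LJ) => /andP[sJ _] _.
    by rewrite cI (cardU dis) // leq_add2r.
  have := linkedU (sep_sym sp) i1 LJ; rewrite setUC (setUC I2) (setUC J).
  move/st; case/andP: (linked_tok LJ) => /andP[sJ _] _.
  by rewrite cI (cardU dis) // leq_add2l.
case=> /stuckP[_ st1] /stuckP[_ st2]; apply/stuckP; split.
  by rewrite /tok (indepU nadj) // cI.
(* Along a walk each projection stays linked to its start at its own level: as [I2] is stuck, the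
   second part never has more than [#|I2|] vertices, so the first keeps at least [l - #|I2|], and
   symmetrically. *)
pose P J := linked V1 (l - #|I2|) I1 (J :&: V1) /\ linked V2 (l - #|I1|) I2 (J :&: V2).
have cV J : indep_in (V1 :|: V2) J -> #|J| = #|J :&: V1| + #|J :&: V2|.
  by move=> /indepU_split[_ _ eJ]; rewrite {1}eJ (cardU dis) ?subsetIr.
have HP J : linked (V1 :|: V2) l (I1 :|: I2) J -> P J.
  move=> L; apply: (linked_ind (P := P) _ _ L).
    rewrite /P (capU1 dis s1 s2) setUC (capU1 _ s2 s1) 1?disjoint_sym //.
    by split; apply: linked_refl.
  move=> {L}J K /andP[iJ lJ] /andP[iK lK] a _ [L1 L2].
  have c1 := st1 _ L1; have c2 := st2 _ L2.
  have [k1 k2 _] := indepU_split iK.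
  have cK := cV _ iK.
  have [[a1 e2]|[a2 e1]] := tar_adj_cap dis iJ iK a; split.
  - apply: linked_trans (L1) _; apply: linked_step a1; first exact: linked_tok L1.
    by rewrite /tok k1 leq_subLR (leq_trans lK) // cK -e2 addnC leq_add2r.
  - by rewrite -e2.
  - by rewrite -e1.
  - apply: linked_trans (L2) _; apply: linked_step a2; first exact: linked_tok L2.
    by rewrite /tok k2 leq_subLR (leq_trans lK) // cK -e1 leq_add2r.
move=> J L; have [L1 L2] := HP J L.
case/andP: (linked_tok L) => iJ _; rewrite cI (cV _ iJ).
by apply: leq_add; [apply: st1|apply: st2].
Qed.

Lemma stuck_indep V l I : stuck V l I -> indep_in V I.
Proof. by case/andP => /andP[]. Qed.

Lemma spec_union V1 V2 a1 a2 q1 q2 m1 m2 m : sep V1 V2 ->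
  spec V1 a1 q1 m1 -> spec V2 a2 q2 m2 ->
  (forall s l, l <= s -> s <= n ->
    (m s <= l) <-> exists s1 s2, [/\ s1 + s2 = s, m1 s1 <= l - s2 & m2 s2 <= l - s1]) ->
  spec (V1 :|: V2) (a1 + a2) (minn (q1 + a2) (q2 + a1)) m.
Proof.
move=> sp [[[M1 iM1 cM1] max1] Q1 S1] [[[M2 iM2 cM2] max2] Q2 S2] Hm.
have [dis nadj] := sp.
have sM1 : M1 \subset V1 by case/andP: iM1.
have sM2 : M2 \subset V2 by case/andP: iM2.
have cV J : indep_in (V1 :|: V2) J -> #|J| = #|J :&: V1| + #|J :&: V2|.
  by move=> /indepU_split[_ _ eJ]; rewrite {1}eJ (cardU dis) ?subsetIr.
split.
- split; first by exists (M1 :|: M2); rewrite ?(indepU nadj) // (cardU dis) // cM1 cM2.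
  move=> I iI; have [k1 k2 _] := indepU_split iI.
  by rewrite cV // leq_add ?max1 ?max2.
- move=> l la; split.
    rewrite leq_min => /andP[l1 l2] I J iI iJ cI cJ.
    have parts K : indep_in (V1 :|: V2) K -> #|K| = a1 + a2 ->
        [/\ indep_in V1 (K :&: V1), indep_in V2 (K :&: V2), #|K :&: V1| = a1,
            #|K :&: V2| = a2 & K = (K :&: V1) :|: (K :&: V2)].
      move=> iK; have [k1 k2 eK] := indepU_split iK.
      rewrite cV // => cK; have [-> ->] := leq_add_eq cK (max1 _ k1) (max2 _ k2).
      by split.
    have [i1 i2 ci1 ci2 ->] := parts I iI cI.
    have [j1 j2 cj1 cj2 ->] := parts J iJ cJ.
    apply: (@linked_trans _ _ _ ((J :&: V1) :|: (I :&: V2))).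
      apply: linkedU => //; rewrite ci2.
      have h1 : l - a2 <= q1 by rewrite leq_subLR addnC.
      have h2 : l - a2 <= a1 by rewrite leq_subLR addnC.
      exact: (proj1 (Q1 _ h2) h1).
    rewrite setUC (setUC _ (I :&: V2)) (setUC _ (J :&: V2)).
    apply: linkedU => //; first exact: sep_sym.
    rewrite cj1; have h1 : l - a1 <= q2 by rewrite leq_subLR addnC.
    have h2 : l - a1 <= a2 by rewrite leq_subLR.
    exact: (proj1 (Q2 _ h2) h1).
  move=> H.
  (* A part never exceeds its independence number, so the other part always keeps the rest of the
     level, and a walk projects to walks on both sides. *)
  have proj J I : linked (V1 :|: V2) l I J ->
      linked V1 (l - a2) (I :&: V1) (J :&: V1) /\ linked V2 (l - a1) (I :&: V2) (J :&: V2).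
    move=> L; have [tI _] := andP L.
    have tkV K : tok (V1 :|: V2) l K -> tok V1 (l - a2) (K :&: V1) /\ tok V2 (l - a1) (K :&: V2).
      move=> /andP[iK lK]; have [k1 k2 _] := indepU_split iK.
      rewrite /tok k1 k2 !leq_subLR !(leq_trans lK) // cV //.
        by rewrite leq_add2r max1.
      by rewrite addnC leq_add2r max2.
    apply: (linked_ind (P := fun J => linked V1 (l - a2) (I :&: V1) (J :&: V1) /\
       linked V2 (l - a1) (I :&: V2) (J :&: V2)) _ _ L).
      by have [] := tkV _ tI; split; apply: linked_refl.
    move=> {L}J' K tJ tK a _ [L1 L2].
    have [j1 j2] := tkV _ tJ; have [k1 k2] := tkV _ tK.
    have [iJ _] := andP tJ; have [iK _] := andP tK.
    have [[a1' e2]|[a2' e1]] := tar_adj_cap dis iJ iK a; split.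
    - by apply: linked_trans (L1) _; apply: linked_step.
    - by rewrite -e2.
    - by rewrite -e1.
    - by apply: linked_trans (L2) _; apply: linked_step.
  have c1 : l - a2 <= q1.
    have la' : l - a2 <= a1 by rewrite leq_subLR addnC.
    apply/(Q1 _ la').
    move=> I J iI iJ cI cJ.
    have sI : I \subset V1 by case/andP: iI.
    have sJ : J \subset V1 by case/andP: iJ.
    have := H (I :|: M2) (J :|: M2) (indepU nadj iI iM2) (indepU nadj iJ iM2).
    rewrite !(cardU dis) // cI cJ cM2 => /(_ erefl erefl)/proj[].
    by rewrite !(capU1 dis).
  have c2 : l - a1 <= q2.
    have la' : l - a1 <= a2 by rewrite leq_subLR.
    apply/(Q2 _ la').
    move=> I J iI iJ cI cJ.
    have sI : I \subset V2 by case/andP: iI.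
    have sJ : J \subset V2 by case/andP: iJ.
    have := H (M1 :|: I) (M1 :|: J) (indepU nadj iM1 iI) (indepU nadj iM1 iJ).
    rewrite !(cardU dis) // cI cJ cM1 => /(_ erefl erefl)/proj[_].
    by rewrite setUC (setUC M1) !(@capU1 V2 V1) // disjoint_sym.
  by rewrite leq_min addnC -leq_subLR c1 addnC -leq_subLR c2.
- move=> s l ls sn; rewrite Hm //; split.
    case=> s1 [s2 [es h1 h2]].
    (* [S1] and [S2] speak only of levels up to the size and of sizes up to [n]. *)
    have [l1 l2] : l - s2 <= s1 /\ l - s1 <= s2 by clear -es ls; lia.
    have [n1 n2] : s1 <= n /\ s2 <= n by clear -es sn; lia.
    have [I1 st1 c1] := proj1 (S1 s1 (l - s2) l1 n1) h1.
    have [I2 st2 c2] := proj1 (S2 s2 (l - s1) l2 n2) h2.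
    have i1 := stuck_indep st1; have i2 := stuck_indep st2.
    have s1' : I1 \subset V1 by case/andP: i1.
    have s2' : I2 \subset V2 by case/andP: i2.
    exists (I1 :|: I2); last by rewrite (cardU dis) // c1 c2.
    by apply/(stuckU sp i1 i2); rewrite c1 c2 ?es.
  case=> I st cI; have iI := stuck_indep st.
  have [i1 i2 eI] := indepU_split iI.
  have cI' := cV _ iI.
  have le' : l <= #|I :&: V1| + #|I :&: V2| by rewrite -cI' cI.
  move: st; rewrite eI => /(stuckU sp i1 i2 le')[st1 st2].
  exists #|I :&: V1|, #|I :&: V2|; split; first by rewrite -cI' cI.
    apply/S1; last by exists (I :&: V1).
      by rewrite leq_subLR addnC.
    by rewrite (leq_trans _ sn) // -cI cI' leq_addr.
  apply/S2; last by exists (I :&: V2).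
    by rewrite leq_subLR.
  by rewrite (leq_trans _ sn) // -cI cI' leq_addl.
Qed.

(** * Joins *)

Definition joined V1 V2 := forall x y, x \in V1 -> y \in V2 -> E x y.

Lemma joined_sym V1 V2 : joined V1 V2 -> joined V2 V1.
Proof. by move=> H x y xV yV; rewrite Esym H. Qed.

Lemma indep_join V1 V2 I : joined V1 V2 ->
  indep_in (V1 :|: V2) I = indep_in V1 I || indep_in V2 I.
Proof.
move=> jn; apply/idP/orP.
  move=> /andP[/subsetP s /independentP i].
  have [/subsetPn[x xI xn]|s1] := boolP (~~ (I \subset V1)); last first.
    by left; rewrite negbK in s1; rewrite /indep_in s1; apply/independentP.
  right; apply/andP; split; last exact/independentP.
  apply/subsetP => y yI; have := s y yI; rewrite inE => /orP[yV|//].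
  have := s x xI; rewrite inE (negPf xn) /= => xV.
  by have := i _ _ yI xI; rewrite jn.
by case=> /andP[s i]; rewrite /indep_in i andbT (subset_trans s) ?subsetUl ?subsetUr.
Qed.

Lemma joined_disjoint V1 V2 : joined V1 V2 -> forall x, x \in V1 -> x \in V2 -> False.
Proof. by move=> jn x x1 x2; have := jn x x x1 x2; rewrite Eirr. Qed.

Lemma linked_mono V V' l I J : V \subset V' -> linked V l I J -> linked V' l I J.
Proof.
move=> s L; have [tI _] := andP L.
have w K : tok V l K -> tok V' l K.
  by case/andP=> /andP[sK iK] lK; rewrite /tok /indep_in iK (subset_trans sK).
apply: (linked_ind (P := linked V' l I) _ _ L); first exact/linked_refl/w.
move=> {L}J K tJ tK a _ L; apply: linked_trans L _.
by apply: linked_step => //; apply: w.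
Qed.

(** Adjacent sets are nested, so at a positive level they share a vertex; as joined parts are
    disjoint, a walk can never change sides. *)
Lemma linkedJ V1 V2 l I J : joined V1 V2 -> 0 < l -> indep_in V1 I ->
  linked (V1 :|: V2) l I J <-> linked V1 l I J.
Proof.
move=> jn l0 iI; split; last by apply: linked_mono; apply: subsetUl.
move=> L; have [/andP[_ lI] _] := andP L.
apply: (linked_ind (P := linked V1 l I) _ _ L).
  by apply: linked_refl; rewrite /tok iI.
move=> {L}J K tJ /andP[iK lK] a _ L; apply: linked_trans (L) _.
have tJ1 := linked_tok L; have [/andP[/subsetP sJ _] lJ] := andP tJ1.
apply: linked_step => //; rewrite /tok lK andbT.
move: iK; rewrite (indep_join K jn) => /orP[//|iK].
have [/subsetP sK _] := andP iK.
have [x xJ xK] : exists2 x, x \in J & x \in K.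
  have [z zJ] : exists z, z \in J by apply/set0Pn; rewrite -card_gt0; lia.
  have [t tK] : exists t, t \in K by apply/set0Pn; rewrite -card_gt0; lia.
  case/orP: a => /existsP[u /andP[/eqP e _]].
    by exists t; rewrite // e !inE tK orbT.
  by exists z; rewrite // e !inE zJ orbT.
by case: (joined_disjoint jn (sJ _ xJ) (sK _ xK)).
Qed.

Lemma stuckJ V1 V2 l I : joined V1 V2 -> 0 < l -> indep_in V1 I ->
  stuck (V1 :|: V2) l I <-> stuck V1 l I.
Proof.
move=> jn l0 iI; have iI' : indep_in (V1 :|: V2) I by rewrite indep_join ?iI.
have E1 J := linkedJ J jn l0 iI.
split=> /stuckP[/andP[_ lI] st]; apply/stuckP; split;
  by [rewrite /tok ?iI ?iI'|move=> J /E1; apply: st].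
Qed.

(** If [a1 = a2], maximum sets on different sides are linked only through the empty set, whence
    [q = 0]. Level 0 is corrected by hand in [m]: there exactly the maximum sets are stuck, so their
    size gets 0 and every other size at least 1. *)
Lemma spec_join V1 V2 a1 a2 q1 q2 m1 m2 m : joined V1 V2 -> 0 < a1 -> 0 < a2 ->
  spec V1 a1 q1 m1 -> spec V2 a2 q2 m2 ->
  (forall s, s <= n -> m s = if s == maxn a1 a2 then 0 else maxn 1 (minn (m1 s) (m2 s))) ->
  spec (V1 :|: V2) (maxn a1 a2) (if a2 < a1 then q1 else if a1 < a2 then q2 else 0) m.
Proof.
move=> jn a10 a20 [Ha1 Q1 S1] [Ha2 Q2 S2] Hm.
have [[M1 iM1 cM1] max1] := Ha1; have [[M2 iM2 cM2] max2] := Ha2.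
have jn' := joined_sym jn.
have Ha : alpha_spec (V1 :|: V2) (maxn a1 a2).
  split.
    case: (leqP a1 a2) => _; [exists M2|exists M1] => //;
      by rewrite indep_join // ?iM1 ?iM2 ?orbT.
  move=> I; rewrite indep_join // leq_max => /orP[/max1->|/max2->] //.
  by rewrite orbT.
split=> //.
- move=> l la; case: (posnP l) => [->|l0].
    by split=> // _ I J iI iJ _ _; apply: linked0.
  case: (ltngtP a2 a1) la => [lt|lt|eq] la.
  + have only I : indep_in (V1 :|: V2) I -> #|I| = a1 -> indep_in V1 I.
      by rewrite indep_join // => /orP[//|/max2 + c]; rewrite c leqNgt lt.
    rewrite Q1 //; split=> H I J iI iJ cI cJ.
      have iI1 := only _ iI cI.
      by apply/(linkedJ J jn l0 iI1)/H => //; apply: only.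
    by apply/(linkedJ J jn l0 iI)/H => //; rewrite indep_join ?iI ?iJ.
  + have only I : indep_in (V1 :|: V2) I -> #|I| = a2 -> indep_in V2 I.
      by rewrite indep_join // => /orP[/max1 + c|//]; rewrite c leqNgt lt.
    rewrite Q2 //; split=> H I J iI iJ cI cJ.
      have iI1 := only _ iI cI.
      by rewrite setUC; apply/(linkedJ J jn' l0 iI1)/H => //; apply: only.
    apply/(linkedJ J jn' l0 iI); rewrite setUC; apply: H => //;
      by rewrite indep_join ?iI ?iJ ?orbT.
  + split; first by lia.
    move=> H; have L : linked (V1 :|: V2) l M1 M2.
      by apply: H; rewrite ?indep_join ?iM1 ?iM2 ?orbT ?cM1.
    move/(linkedJ M2 jn l0 iM1): L => /linked_tok/andP[/andP[/subsetP s1 _] _].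
    have [/subsetP s2 _] := andP iM2.
    have [z zM] : exists z, z \in M2 by apply/set0Pn; rewrite -card_gt0; lia.
    by case: (joined_disjoint jn (s1 _ zM) (s2 _ zM)).
- move=> s l ls sn; rewrite Hm //; case: eqVneq => [es|nes].
    split=> // _; have [[M iM cM] _] := Ha; exists M; last by rewrite cM.
    by apply: (stuck_le (leq0n l)); [rewrite cM -es|apply/(stuck0 _ Ha)].
  rewrite geq_max geq_min; split.
    case/andP=> l0 /orP[/(S1 _ _ ls sn)|/(S2 _ _ ls sn)] [I st cI];
      exists I => //; have iI := stuck_indep st; first exact/stuckJ.
    by rewrite setUC; apply/stuckJ.
  case=> I st cI; case: (posnP l) => [l0|l0].
    by move: st; rewrite l0 => /(stuck0 _ Ha)[_ c]; rewrite -cI c eqxx in nes.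
  have := stuck_indep st; rewrite indep_join // => /orP[] iI /=; apply/orP; [left|right].
    by apply/(S1 _ _ ls sn); exists I => //; apply/(stuckJ jn l0 iI).
  by apply/(S2 _ _ ls sn); exists I => //; apply/(stuckJ jn' l0 iI); rewrite setUC.
Qed.

End Reconfiguration.

(** * Splits and twins in cographs *)

Section Twins.
Variables (n : nat).
Implicit Types (S A B : {set 'I_n}) (E : rel 'I_n).

Definition homog E c A B := forall x y, x \in A -> y \in B -> E x y = c.

(** For [c = false] the induced subgraph is disconnected, for [c = true] its complement is. *)
Definition splits E c S := exists A B,
  [/\ A != set0, B != set0, S = A :|: B, [disjoint A & B] & homog E c A B].

Definition co E : rel 'I_n := fun x y => (x != y) && ~~ E x y.

Lemma co_sym E : symmetric E -> symmetric (co E).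
Proof. by move=> Es x y; rewrite /co eq_sym Es. Qed.

Lemma co_irr E : irreflexive (co E).
Proof. by move=> x; rewrite /co eqxx. Qed.

Lemma co_cograph E : symmetric E -> cograph E -> cograph (co E).
Proof.
move=> Es P4 a b c d u [ab bc cd /and3P[ac bd ad]].
(* The path on four vertices is self-complementary: the non-edges of the path [a b c d] form the
   path [b d a c]. *)
have u' : uniq [:: b; d; a; c].
  move: u; rewrite /= !inE !negb_or !(eq_sym b) !(eq_sym d).
  by move=> /and4P[/and3P[-> -> ->] /andP[-> ->] ->].
apply: (P4 _ _ _ _ u'); move: u ab bc cd ac bd ad; rewrite /co /= !inE !negb_or.
move=> /and4P[/and3P[n1 n2 n3] /andP[n4 n5] n6 _].
rewrite n1 n2 n3 n4 n5 n6 /= !negbK (Es b a) (Es d a) (Es d c) => -> -> -> -> -> ->.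
by [].
Qed.

Lemma splits_co E c S : splits (co E) c S -> splits E (~~ c) S.
Proof.
move=> [A [B [nA nB eS dj H]]]; exists A, B; split=> // x y xA yB.
have := H x y xA yB; rewrite /co.
have -> : x != y by apply/eqP => exy; move/pred0P/(_ x): dj; rewrite /= xA exy yB.
by move=> /= <-; rewrite negbK.
Qed.

(* If [S :\ x] splits with no edges across and [S] does not split, then [x] has
   a non-neighbour in one part and, inside that part, an edge between its
   non-neighbours and its neighbours; with a neighbour of [x] in the other part
   this is an induced path. *)
Lemma splits_add E S x : symmetric E -> irreflexive E -> cograph E -> x \notin S ->
  splits E false S -> exists c, splits E c (x |: S).
Proof.
move=> Es Ei P4 xS [A [B [nA nB eS dj H]]].
have [/forall_inP allN|/forall_inPn[y yS yn]] := boolP [forall y in S, E x y].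
  exists true, [set x], S; split => //.
  - by apply/set0Pn; exists x; rewrite inE.
  - by apply: contraNneq nA => S0; rewrite -subset0 -S0 eS subsetUl.
  - by rewrite disjoints1.
  - by move=> u v /set1P->; apply: allN.
exists false.
have {yS} : y \in A :|: B by rewrite -eS.
wlog yA : A B nA nB eS dj H / y \in A.
  move=> W; rewrite inE => /orP[] yAB.
    by apply: (W A B) => //; rewrite inE yAB.
  apply: (W B A) => //; first by rewrite setUC.
  - by rewrite disjoint_sym.
  - by move=> u v uB vA; rewrite Es H.
  - by rewrite inE yAB.
move=> _.
have djP z : z \in A -> z \in B -> False.
  by move=> zA zB; move/pred0P/(_ z): dj; rewrite /= zA zB.
pose N := [set z | E x z].
have [/exists_inP[w wB xw]|nw] := boolP [exists w in B, E x w]; last first.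
  exists (x |: A), B; split=> //.
  - by apply/set0Pn; exists x; rewrite !inE eqxx.
  - by rewrite eS setUA.
  - apply/pred0P => z; apply/negP => /andP[/= /setU1P[->|zA] zB].
      by move: xS; rewrite eS inE zB orbT.
    exact: (djP z).
  - move=> u v /setU1P[->|uA] vB; last exact: H.
    by apply: contraNF nw => e; apply/exists_inP; exists v.
exists (A :\: N), ((x |: S) :\: (A :\: N)); split.
- by apply/set0Pn; exists y; rewrite !inE yn.
- apply/set0Pn; exists x; rewrite !inE eqxx /= andbT negb_and negbK.
  by apply/orP; right; apply: contra xS => xA; rewrite eS inE xA.
- rewrite setUC setDUl; apply/setP => z; rewrite !inE eS !inE.
  by case: (z == x); case: (z \in A); case: (z \in B); case: (E x z).
- by rewrite disjoints_subset; apply/subsetP => z; rewrite !inE => ->.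
move=> a z; rewrite !inE => /andP[xa aA] /andP[Hz zS].
have [->|nzx] := eqVneq z x; first by rewrite Es; apply/negbTE.
rewrite (negPf nzx) /= eS inE in zS.
have [zA|nzA] := boolP (z \in A); last by apply: H; rewrite // (negPf nzA) in zS.
rewrite zA andbT negbK in Hz.
apply/negP => az.
have xP t : t \in A \/ t \in B -> t != x.
  by move=> tAB; apply: contraNneq xS => <-; rewrite eS inE; apply/orP.
have ax := xP a (or_introl aA); have wx := xP w (or_intror wB).
have aw : a != w by apply/eqP => e; apply: (djP a); rewrite // e.
have zw : z != w by apply/eqP => e; apply: (djP z); rewrite // e.
have naz : a != z by apply/eqP => e; rewrite e Ei in az.
apply: (P4 a z x w).
  by rewrite /= !inE !negb_or naz ax aw nzx zw eq_sym wx.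
by rewrite az Es Hz xw (Es a x) xa !H.
Qed.

(** This is Seinsche's theorem. One vertex is removed; if the rest splits as a join, passing to the
    complement, which is again a cograph, makes [splits_add] applicable. *)
Lemma cograph_splits E S : symmetric E -> irreflexive E -> cograph E ->
  1 < #|S| -> exists c, splits E c S.
Proof.
move=> Es Ei P4; move: {2}#|S| (leqnn #|S|) => k.
elim: k S => [|k IH] S Sk S1; first by lia.
have [x xS] : exists x, x \in S by apply/set0Pn; rewrite -card_gt0; lia.
have cS : #|S| = #|S :\ x|.+1 by rewrite (cardsD1 x S) xS.
have eS : x |: (S :\ x) = S by rewrite setD1K.
case: (ltnP 1 #|S :\ x|) => [lt|le]; last first.
  have [y yS] : exists y, y \in S :\ x by apply/set0Pn; rewrite -card_gt0; lia.
  exists (E x y), [set x], (S :\ x); split.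
  - by apply/set0Pn; exists x; rewrite inE.
  - by apply/set0Pn; exists y.
  - by rewrite eS.
  - by rewrite disjoints1 !inE eqxx.
  - move=> u v /set1P-> vS; congr (E x _).
    have/cards1P[z ez] : #|S :\ x| == 1 by apply/eqP; lia.
    by move: vS yS; rewrite ez => /set1P-> /set1P->.
rewrite -eS; have xn : x \notin S :\ x by rewrite !inE eqxx.
have [|[] sp] := IH _ _ lt; first by lia.
  have sp' : splits (co E) false (S :\ x).
    case: sp => A [B [nA nB eS' dj H]]; exists A, B; split=> // u v uA vB.
    by rewrite /co H // andbF.
  have [c spc] := splits_add (co_sym Es) (@co_irr E) (co_cograph Es P4) xn sp'.
  by exists (~~ c); apply: splits_co.
exact: splits_add.
Qed.

Definition twins E S u v := [/\ u \in S, v \in S, u != v &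
  forall w, w \in S -> w != u -> w != v -> E u w = E v w].

(** Twins inside one part of a split remain twins in [S], since every vertex of the other part sees
    them alike. If both parts are singletons, these two vertices are twins. *)
Lemma cograph_twins E S : symmetric E -> irreflexive E -> cograph E ->
  1 < #|S| -> exists u v, twins E S u v.
Proof.
move=> Es Ei P4; move: {2}#|S| (leqnn #|S|) => k.
elim: k S => [|k IH] S Sk S1; first by lia.
have [c [A [B [nA nB eS dj H]]]] := cograph_splits Es Ei P4 S1.
have cAB : #|S| = #|A| + #|B|.
  by rewrite eS; apply/eqP; rewrite leq_card_setU.
have sub A' B' : S = A' :|: B' -> homog E c A' B' -> 1 < #|A'| -> #|A'| <= k ->
    exists u v, twins E S u v.
  move=> eS' H' A1 Ak; have [u [v [uA vA nuv Huv]]] := IH A' Ak A1.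
  exists u, v; split; rewrite ?eS' ?inE ?uA ?vA // => w.
  by rewrite inE => /orP[/Huv//|wB] _ _; rewrite !H'.
rewrite -!card_gt0 in nA nB.
have [A1|A1] := ltnP 1 #|A|; first by apply: (sub A B) => //; lia.
have [B1|B1] := ltnP 1 #|B|.
  apply: (sub B A) => //; [by rewrite setUC|by move=> x y xB yA; rewrite Es H|lia].
have /cards1P[u eu] : #|A| == 1 by lia.
have /cards1P[v ev] : #|B| == 1 by lia.
exists u, v; rewrite eS eu ev; split; rewrite ?inE ?eqxx ?orbT //.
  by apply/eqP => e; move/pred0P/(_ u): dj; rewrite eu ev /= !inE e eqxx.
by move=> w; rewrite !inE => /orP[]->.
Qed.

(** The rows of [u] and [v] differ at [u] and at [v] exactly when the two are adjacent, which
    accounts for [E u v + E u v]; every further difference is a witness against being twins. *)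
Lemma twins_count E S u v : symmetric E -> irreflexive E ->
  u \in S -> v \in S -> u != v ->
  (#|[set w in S | E u w != E v w]| <= E u v + E u v) <-> twins E S u v.
Proof.
move=> Es Ei uS vS nuv; set D := [set w in S | _].
have D0 : (E u v) = (u \in D) by rewrite inE uS Ei Es; case: (E v u).
have D1 : (E u v) = (v \in D) by rewrite inE vS Ei; case: (E u v).
have cD : #|D| = E u v + E u v + #|D :\ u :\ v|.
  rewrite (cardsD1 u) -D0 (cardsD1 v (D :\ u)) -addnA.
  by rewrite [v \in D :\ u]inE inE eq_sym nuv -D1.
rewrite cD -[X in _ <= X]addn0 leq_add2l leqn0 cards_eq0; split.
  move=> /eqP D00; split=> // w wS wu wv; apply/eqP; apply: contraT => nw.
  by have := in_set0 w; rewrite -D00 !inE wu wv wS nw.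
case=> _ _ _ H; rewrite -subset0; apply/subsetP => w.
by rewrite !inE => /and4P[wv wu wS]; rewrite H // eqxx.
Qed.
End Twins.

(** * A structured language and its compilation *)

Inductive expr :=
  | Var of nat | Cst of nat | Plus of expr & expr | Minus of expr & expr
  | Get of nat & expr.

Inductive com :=
  | Skip
  | Asgn of nat & expr
  | Put of nat & expr & expr
  | Seq of com & com
  | If of expr & com & com
  | For of nat & nat & com.

(* Row 0 of a state holds the scalar variables, the other rows hold arrays. *)
Definition state := nat -> nat -> nat.

Definition supd (s : state) j i v : state :=
  fun j' i' => if (j' == j) && (i' == i) then v else s j' i'.

Fixpoint evalE (s : state) e :=
  match e with
  | Var r => s 0 r
  | Cst v => v
  | Plus a b => evalE s a + evalE s b
  | Minus a b => evalE s a - evalE s b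
  | Get j a => s j (evalE s a)
  end.

(** After a [For] the counter equals the bound, as in the compiled loop: [sim] demands that all
    variables agree. *)
Fixpoint eval (c : com) (s : state) : state :=
  match c with
  | Skip => s
  | Asgn r e => supd s 0 r (evalE s e)
  | Put j a b => supd s j (evalE s a) (evalE s b)
  | Seq c1 c2 => eval c2 (eval c1 s)
  | If e c1 c2 => if evalE s e == 0 then eval c2 s else eval c1 s
  | For x y c =>
      supd (iteri (s 0 y) (fun i s' => eval c (supd s' 0 x i)) s) 0 x (s 0 y)
  end.

(** A [Put] counts as writing its whole row, because its index is known only at run time. *)
Fixpoint writes (c : com) (j i : nat) : bool :=
  match c with
  | Skip => false
  | Asgn r _ => (j == 0) && (i == r)
  | Put j' _ _ => j == j'
  | Seq c1 c2 | If _ c1 c2 => writes c1 j i || writes c2 j i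
  | For x _ c => ((j == 0) && (i == x)) || writes c j i
  end.

Fixpoint wfE e :=
  match e with
  | Plus a b | Minus a b => wfE a && wfE b
  | Get j a => (j < 15) && wfE a
  | _ => true
  end.

(* Variables 0, 1, 2 are read-only, and only they may bound a loop; row 15 is
   reserved for the temporaries of the compiled code. *)
Fixpoint wf c :=
  match c with
  | Skip => true
  | Asgn r e => (2 < r) && wfE e
  | Put j a b => [&& 0 < j, j < 15, wfE a & wfE b]
  | Seq c1 c2 => wf c1 && wf c2
  | If e c1 c2 => [&& wfE e, wf c1 & wf c2]
  | For x y c => [&& 2 < x, y < 3, ~~ writes c 0 x & wf c]
  end.

Lemma iteri_ind (T : Type) (P : nat -> T -> Prop) n f (x : T) :
  P 0 x -> (forall i y, i < n -> P i y -> P i.+1 (f i y)) -> P n (iteri n f x).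
Proof.
move=> P0; elim: n => [//|n IH] Pf /=; apply: (Pf) => //.
by apply: IH => i y lt_in; apply: Pf; apply: leqW.
Qed.

Lemma eval_frame c s j i : ~~ writes c j i -> eval c s j i = s j i.
Proof.
elim: c s => //= [r e|j' a b|c1 IH1 c2 IH2|e c1 IH1 c2 IH2|x y c IH] s.
- by rewrite /supd => /negPf->.
- by rewrite /supd => /negPf->.
- by rewrite negb_or => /andP[w1 w2]; rewrite IH2 // IH1.
- by rewrite negb_or => /andP[w1 w2]; case: ifP => _; [apply: IH2|apply: IH1].
- rewrite negb_or => /andP[/negPf nx w]; rewrite /supd nx.
  apply: (iteri_ind (P := fun _ s' => s' j i = s j i)) => // k s' _ Hs'.
  by rewrite IH // nx.
Qed.

Lemma wf_readonly c y : wf c -> y < 3 -> ~~ writes c 0 y.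
Proof.
move=> + lty; elim: c => //=.
- by move=> r e /andP[ltr _]; apply/eqP => eyr; rewrite -eyr ltnNge -ltnS lty in ltr.
- by move=> j a b /andP[]; case: j.
- by move=> c1 IH1 c2 IH2 /andP[/IH1 w1 /IH2 w2]; rewrite negb_or w1.
- by move=> e c1 IH1 c2 IH2 /and3P[_ /IH1 w1 /IH2 w2]; rewrite negb_or w1.
- move=> x z c IH /and4P[ltx _ _ /IH w]; rewrite negb_or w andbT.
  by apply/eqP => eyx; rewrite -eyx ltnNge -ltnS lty in ltx.
Qed.

Lemma eval_readonly c s y : wf c -> y < 3 -> eval c s 0 y = s 0 y.
Proof. by move=> wfc lty; apply/eval_frame/wf_readonly. Qed.

(* Rows are interleaved in memory, so that every row is unbounded; the cells
   below 8 are used only before and after the compiled code. *)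
Definition addr j i := 8 + 16 * i + j.
Definition tmp d := addr 15 d.

Lemma addr_inj j i j' i' : j < 16 -> j' < 16 ->
  (addr j i == addr j' i') = (j == j') && (i == i').
Proof.
rewrite /addr => lt lt'; apply/eqP/andP; [move=> ?|case=> /eqP-> /eqP->] => //.
by split; apply/eqP; lia.
Qed.

Lemma tmp_eq d d' : (tmp d == tmp d') = (d == d').
Proof. by rewrite addr_inj. Qed.

(** The temporaries form an evaluation stack of height [d]. The zero added for [Var] replaces a
    missing copy instruction; four doublings multiply an index by 16, as [addr] requires. *)
Fixpoint compE d e : seq instr :=
  match e with
  | Var r => [:: IConst (tmp d.+1) 0; IAdd (tmp d) (addr 0 r) (tmp d.+1)]
  | Cst v => [:: IConst (tmp d) v]
  | Plus a b => compE d a ++ compE d.+1 b ++ [:: IAdd (tmp d) (tmp d) (tmp d.+1)]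
  | Minus a b => compE d a ++ compE d.+1 b ++ [:: ISub (tmp d) (tmp d) (tmp d.+1)]
  | Get j a => compE d a ++
      nseq 4 (IAdd (tmp d) (tmp d) (tmp d)) ++
      [:: IConst (tmp d.+1) (8 + j); IAdd (tmp d) (tmp d) (tmp d.+1);
          IRead (tmp d) (tmp d)]
  end.

Definition asgn_code r e : seq instr :=
  compE 0 e ++ [:: IConst (tmp 1) 0; IAdd (addr 0 r) (tmp 0) (tmp 1)].

Definition put_code j a b : seq instr :=
  compE 0 a ++ nseq 4 (IAdd (tmp 0) (tmp 0) (tmp 0)) ++
  [:: IConst (tmp 1) (8 + j); IAdd (tmp 0) (tmp 0) (tmp 1)] ++
  compE 1 b ++ [:: IWrite (tmp 0) (tmp 1)].

Definition jump l : seq instr := [:: IConst (tmp 0) 0; IJz (tmp 0) l].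

Fixpoint csize c :=
  match c with
  | Skip => 0
  | Asgn r e => size (asgn_code r e)
  | Put j a b => size (put_code j a b)
  | Seq c1 c2 => csize c1 + csize c2
  | If e c1 c2 => size (compE 0 e) + 1 + csize c1 + 2 + csize c2
  | For x y c => size (asgn_code x (Cst 0)) + size (compE 0 (Minus (Var y) (Var x)))
       + 1 + csize c + size (asgn_code x (Plus (Var x) (Cst 1))) + 2
  end.

Fixpoint compile pc c : seq instr :=
  match c with
  | Skip => [::]
  | Asgn r e => asgn_code r e
  | Put j a b => put_code j a b
  | Seq c1 c2 => compile pc c1 ++ compile (pc + csize c1) c2
  | If e c1 c2 =>
      let p1 := pc + size (compE 0 e) + 1 in
      let p2 := p1 + csize c1 + 2 in
      compE 0 e ++ IJz (tmp 0) p2 :: compile p1 c1 ++ jump (p2 + csize c2) ++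
      compile p2 c2
  | For x y c =>
      let p0 := pc + size (asgn_code x (Cst 0)) in
      let p1 := p0 + size (compE 0 (Minus (Var y) (Var x))) + 1 in
      asgn_code x (Cst 0) ++ compE 0 (Minus (Var y) (Var x)) ++
      IJz (tmp 0) (pc + csize (For x y c)) :: compile p1 c ++
      asgn_code x (Plus (Var x) (Cst 1)) ++ jump p0
  end.

Lemma size_compile pc c : size (compile pc c) = csize c.
Proof.
elim: c pc => //= [c1 IH1 c2 IH2|e c1 IH1 c2 IH2|x y c IH] pc.
- by rewrite size_cat IH1 IH2.
- by rewrite !size_cat /= !size_cat /= IH1 IH2; lia.
- by rewrite !size_cat /= IH; lia.
Qed.

Definition jump_free i := match i with IJz _ _ | IHalt => false | _ => true end.

Definition exec1 (m : memory) i : memory := (step [:: i] (0, m)).2.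

Definition exec := foldl exec1.

Lemma exec_cat m l1 l2 : exec m (l1 ++ l2) = exec (exec m l1) l2.
Proof. exact: foldl_cat. Qed.

Definition code_at (p : program) pc (l : seq instr) :=
  forall i, i < size l -> nth IHalt p (pc + i) = nth IHalt l i.

Lemma code_at_cat p pc l1 l2 : code_at p pc (l1 ++ l2) ->
  code_at p pc l1 /\ code_at p (pc + size l1) l2.
Proof.
move=> H; split=> i lt_i.
  by rewrite H ?size_cat ?nth_cat ?lt_i // ltn_addr.
rewrite -addnA H ?size_cat ?ltn_add2l // nth_cat.
by rewrite ltnNge leq_addr /= addKn.
Qed.

Lemma code_at_cons p pc i l : code_at p pc (i :: l) ->
  nth IHalt p pc = i /\ code_at p (pc + 1) l.
Proof.
move=> H; split; first by have := H 0 isT; rewrite addn0.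
by move=> k ltk; rewrite -addnA add1n (H k.+1).
Qed.

(** The time is only an upper bound, so that one estimate can cover both branches of a
    conditional. *)
Definition reaches p c t c' := exists2 t', t' <= t & run p t' c = c'.

Lemma reaches_refl p c : reaches p c 0 c.
Proof. by exists 0. Qed.

Lemma reaches_trans p t1 t2 c1 c2 c3 :
  reaches p c1 t1 c2 -> reaches p c2 t2 c3 -> reaches p c1 (t1 + t2) c3.
Proof.
move=> [u1 le1 r1] [u2 le2 r2]; exists (u1 + u2); first exact: leq_add.
by rewrite addnC /run iterD -/(run p u1 c1) r1.
Qed.

Lemma reaches_le p t t' c c' : t <= t' -> reaches p c t c' -> reaches p c t' c'.
Proof. by move=> le [u leu r]; exists u => //; apply: leq_trans le. Qed.

Lemma reaches_jz p pc r l m : nth IHalt p pc = IJz r l ->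
  reaches p (pc, m) 1 (if m r == 0 then l else pc + 1, m).
Proof. by move=> H; exists 1 => //=; rewrite H addn1. Qed.

Lemma reaches_const p pc d v m : nth IHalt p pc = IConst d v ->
  reaches p (pc, m) 1 (pc + 1, upd m d v).
Proof. by move=> H; exists 1 => //=; rewrite H addn1. Qed.

Lemma reaches_jump p pc l m : code_at p pc (jump l) ->
  reaches p (pc, m) 2 (l, upd m (tmp 0) 0).
Proof.
move=> /code_at_cons[H0 /code_at_cons[H1 _]].
have := reaches_jz (upd m (tmp 0) 0) H1; rewrite {2}/upd eqxx /=.
exact: (@reaches_trans _ 1 1) (reaches_const m H0).
Qed.

Lemma reaches_exec p pc l m : all jump_free l -> code_at p pc l ->
  reaches p (pc, m) (size l) (pc + size l, exec m l).
Proof.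
elim: l pc m => [|i l IH] pc m /=; first by rewrite addn0 => _ _; apply: reaches_refl.
move=> /andP[jf jfl] /code_at_cons[Hi Hl].
rewrite -add1n addnA; apply: reaches_trans (IH _ _ jfl Hl).
by exists 1 => //=; rewrite Hi /exec1 /= addn1; case: i jf {Hi}.
Qed.

Lemma compE_jump_free d e : all jump_free (compE d e).
Proof.
elim: e d => //= [a IHa b IHb|a IHa b IHb|j a IHa] d;
  by rewrite !all_cat ?IHa ?IHb.
Qed.

Definition sim (s : state) (m : memory) :=
  forall j i, j < 15 -> m (addr j i) = s j i.

Lemma addr_tmp j i d : j < 15 -> (addr j i == tmp d) = false.
Proof. by move=> ltj; rewrite addr_inj ?(leqW ltj) // ltn_eqF. Qed.

(** The second claim protects the stack: the temporaries below [d] survive, so a left operand is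
    still there once the right one has been evaluated. *)
Lemma exec_compE s m d e : sim s m -> wfE e ->
  exec m (compE d e) (tmp d) = evalE s e /\
  (forall a, (forall d', d <= d' -> a != tmp d') -> exec m (compE d e) a = m a).
Proof.
move=> + + ; elim: e d m => /=.
- move=> r d m sm _; rewrite /exec /= /exec1 /= /upd !tmp_eq addr_tmp // !eqxx sm //.
  split; first exact: addn0.
  by move=> a Ha; rewrite (negPf (Ha d _)) // (negPf (Ha d.+1 _)).
- move=> v d m sm _; rewrite /exec /= /exec1 /= /upd eqxx; split=> // a Ha.
  by rewrite (negPf (Ha d _)).
- move=> a IHa b IHb d m sm /andP[wa wb].
  rewrite !exec_cat; have [va fa] := IHa d m sm wa.
  set m1 := exec m _ in va fa *.
  have sm1 : sim s m1.
    by move=> j i ltj; rewrite fa ?sm // => d' _; rewrite addr_tmp.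
  have [vb fb] := IHb d.+1 m1 sm1 wb.
  set m2 := exec m1 _ in vb fb *.
  rewrite /exec /= /exec1 /= /upd /= eqxx vb fb ?va; last first.
    by move=> d' ltd; rewrite tmp_eq ltn_eqF.
  split=> // x Hx; rewrite (negPf (Hx d _)) // fb ?fa // => d' ltd.
  by apply: Hx; apply: ltnW.
- move=> a IHa b IHb d m sm /andP[wa wb].
  rewrite !exec_cat; have [va fa] := IHa d m sm wa.
  set m1 := exec m _ in va fa *.
  have sm1 : sim s m1.
    by move=> j i ltj; rewrite fa ?sm // => d' _; rewrite addr_tmp.
  have [vb fb] := IHb d.+1 m1 sm1 wb.
  set m2 := exec m1 _ in vb fb *.
  rewrite /exec /= /exec1 /= /upd /= eqxx vb fb ?va; last first.
    by move=> d' ltd; rewrite tmp_eq ltn_eqF.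
  split=> // x Hx; rewrite (negPf (Hx d _)) // fb ?fa // => d' ltd.
  by apply: Hx; apply: ltnW.
- move=> j a IHa d m sm /andP[ltj wa].
  rewrite !exec_cat; have [va fa] := IHa d m sm wa.
  set m1 := exec m _ in va fa *.
  have sm1 : sim s m1.
    by move=> j' i ltj'; rewrite fa ?sm // => d' _; rewrite addr_tmp.
  rewrite /exec /= /exec1 /= /upd !tmp_eq !eqxx ?(gtn_eqF (ltnSn d)) ?(ltn_eqF (ltnSn d)) va.
  split.
    have -> : forall x, x + x + (x + x) + (x + x + (x + x)) +
      (x + x + (x + x) + (x + x + (x + x))) + (8 + j) = addr j x.
      by move=> x; rewrite /addr; lia.
    by rewrite !addr_tmp // sm1.
  move=> x Hx; rewrite !(negPf (Hx d _)) // !(negPf (Hx d.+1 _)) //.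
  exact: fa.
Qed.

Lemma sim_exec_compE s m d e : sim s m -> wfE e -> sim s (exec m (compE d e)).
Proof.
move=> sm we j i ltj; have [_ ->] := exec_compE d sm we; first exact: sm.
by move=> d' _; rewrite addr_tmp.
Qed.

Lemma sim_asgn s m r e : sim s m -> wfE e ->
  sim (supd s 0 r (evalE s e)) (exec m (asgn_code r e)).
Proof.
move=> sm we; rewrite /asgn_code exec_cat.
have [v f] := exec_compE 0 sm we; have := sim_exec_compE 0 sm we.
move: v f; set m1 := exec m _ => v f sm1 j i ltj.
rewrite /exec /= /exec1 /= /upd /supd addr_inj ?(leqW ltj) // !tmp_eq /= v addn0.
by case: ifP => // _; rewrite addr_tmp ?sm1.
Qed.

Lemma sim_put s m j a b : sim s m -> j < 15 -> wfE a -> wfE b ->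
  sim (supd s j (evalE s a) (evalE s b)) (exec m (put_code j a b)).
Proof.
move=> sm ltj wa wb; rewrite /put_code !exec_cat.
have [va fa] := exec_compE 0 sm wa; have := sim_exec_compE 0 sm wa.
move: va fa; set m1 := exec m _ => va fa sm1.
set m2 := exec (exec m1 _) _.
have vm2 : m2 (tmp 0) = addr j (evalE s a).
  rewrite /m2 /exec /= /exec1 /= /upd !tmp_eq !eqxx /= va.
  by rewrite /addr; lia.
have sm2 : sim s m2.
  by move=> j' i' ltj'; rewrite /m2 /exec /= /exec1 /= /upd !addr_tmp ?sm1.
have [vb fb] := exec_compE 1 sm2 wb; have := sim_exec_compE 1 sm2 wb.
move: vb fb; set m3 := exec m2 _ => vb fb sm3 j' i' ltj'.
rewrite /exec /= /exec1 /= /upd fb ?vm2; last by move=> d' ltd; rewrite tmp_eq ltn_eqF.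
by rewrite addr_inj ?(leqW ltj) ?(leqW ltj') // /supd vb sm3.
Qed.

#[local] Arguments compE : simpl never.
#[local] Arguments asgn_code : simpl never.
#[local] Arguments put_code : simpl never.
#[local] Arguments jump : simpl never.

(** A coefficient for the time bound, chosen generously: both branches of a conditional are added
    up, and twice the length of an empty loop covers initialisation, tests and increments. *)
Fixpoint kost c :=
  match c with
  | Seq c1 c2 => kost c1 + kost c2
  | If e c1 c2 => size (compE 0 e) + 3 + kost c1 + kost c2
  | For x y c => csize (For x y Skip) * 2 + kost c
  | c => csize c
  end.

Fixpoint depth c :=
  match c with
  | Seq c1 c2 | If _ c1 c2 => maxn (depth c1) (depth c2)
  | For _ _ c => (depth c).+1
  | _ => 0
  end.

Lemma compile_For pc x y c :
  let p0 := pc + size (asgn_code x (Cst 0)) in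
  let p1 := p0 + size (compE 0 (Minus (Var y) (Var x))) + 1 in
  compile pc (For x y c) =
    asgn_code x (Cst 0) ++ compE 0 (Minus (Var y) (Var x)) ++
    IJz (tmp 0) (pc + csize (For x y c)) :: compile p1 c ++
    asgn_code x (Plus (Var x) (Cst 1)) ++ jump p0.
Proof. by []. Qed.

(** [N] bounds the read-only variables and hence every loop bound throughout the run, so each level
    of nesting multiplies the time by at most [N.+1]. *)
Lemma reaches_compile p N c : wf c -> forall pc s m,
  (forall y, y < 3 -> s 0 y <= N) -> sim s m -> code_at p pc (compile pc c) ->
  exists2 m', sim (eval c s) m' &
    reaches p (pc, m) (kost c * N.+1 ^ depth c) (pc + csize c, m').
Proof.
elim: c => [|r e|j a b|c1 IH1 c2 IH2|e c1 IH1 c2 IH2|x y c IH]; last first.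
- rewrite [wf _]/= => /and4P[ltx lty nwx wfc] pc s m Hs sm.
  rewrite compile_For [eval _ _]/= [kost _]/= [depth _]/=.
  set p0 := pc + size (asgn_code x (Cst 0)).
  set e := Minus (Var y) (Var x); set ce := compE 0 _.
  set inc := asgn_code x (Plus _ _); set pend := pc + _.
  move=> /code_at_cat[H0 /code_at_cat[He /code_at_cons[Hj /code_at_cat[Hc]]]].
  rewrite size_compile => /code_at_cat[Hi Hk].
  set F := fun i s' => eval c (supd s' 0 x i).
  have nyx : (y == x) = false by apply/eqP => yx; rewrite -yx in ltx; lia.
  have ro i z : z < 3 -> iteri i F s 0 z = s 0 z.
    move=> ltz; elim: i => //= i <-; rewrite /F eval_readonly // /supd.
    by rewrite [z == x](_ : _ = false) //; apply/eqP => zx; rewrite -zx in ltx; lia.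
  set W := size ce + 1 + kost c * N.+1 ^ depth c + size inc + 2.
  (* At the loop head after [i] rounds the memory simulates [i] iterations, with the counter at [i];
     [W] bounds the cost of one round. *)
  have body i : i <= s 0 y -> exists2 m', sim (supd (iteri i F s) 0 x i) m' &
      reaches p (p0, exec m (asgn_code x (Cst 0))) (i * W) (p0, m').
    elim: i => [_|i IHi lti].
      exists (exec m (asgn_code x (Cst 0))); first exact: (@sim_asgn _ _ _ (Cst 0)).
      by rewrite mul0n; apply: reaches_refl.
    have {IHi} [m1 sm1 R1] := IHi (ltnW lti).
    have we : wfE e by [].
    have RE := reaches_exec m1 (compE_jump_free 0 e) He.
    have [v _] := exec_compE 0 sm1 we; have := sim_exec_compE 0 sm1 we.
    move: v RE; rewrite -/ce; set m2 := exec m1 ce => v RE sm2.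
    have RJ := reaches_jz m2 Hj.
    move: v RJ; rewrite [evalE _ _]/= {1 2}/supd !eqxx nyx ro // => ->.
    rewrite subn_eq0 leqNgt lti => RJ.
    have Hs2 z : z < 3 -> supd (iteri i F s) 0 x i 0 z <= N.
      move=> ltz; rewrite /supd [z == x](_ : _ = false) ?ro ?Hs //.
      by apply/eqP => zx; rewrite -zx in ltx; lia.
    have [m3 sm3 R3] := IH wfc _ _ _ Hs2 sm2 Hc.
    have wi : wfE (Plus (Var x) (Cst 1)) by [].
    have jfi : all jump_free inc by rewrite all_cat compE_jump_free.
    have R4 := reaches_exec m3 jfi Hi.
    have := sim_asgn x sm3 wi.
    move: R4; rewrite -/inc; set m4 := exec m3 inc => R4 sm4.
    have R5 := reaches_jump m4 Hk.
    exists (upd m4 (tmp 0) 0).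
      move=> j k ltj; rewrite /upd addr_tmp // sm4 // {1}/supd /=.
      by rewrite eval_frame // /supd /= eqxx addn1.
    have := reaches_trans R1 (reaches_trans RE (reaches_trans RJ (reaches_trans R3
      (reaches_trans R4 R5)))).
    by apply: reaches_le; rewrite mulSn /W; lia.
  have [m1 sm1 R1] := body _ (leqnn _).
  have we : wfE e by [].
  have RE := reaches_exec m1 (compE_jump_free 0 e) He.
  have [v _] := exec_compE 0 sm1 we; have := sim_exec_compE 0 sm1 we.
  move: v RE; rewrite -/ce; set m2 := exec m1 ce => v RE sm2.
  have RJ := reaches_jz m2 Hj.
  move: v RJ; rewrite [evalE _ _]/= {1 2}/supd !eqxx nyx ro // => ->.
  rewrite subnn => RJ.
  exists m2 => //.
  have R0 := reaches_exec m (isT : all jump_free (asgn_code x (Cst 0))) H0.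
  have := reaches_trans R0 (reaches_trans R1 (reaches_trans RE RJ)).
  apply: reaches_le.
  have leN := Hs y lty.
  have : s 0 y * W <= N * W by rewrite leq_mul2r leN orbT.
  move: (s 0 y * W) => Y leY.
  have K_gt0 : 0 < N.+1 ^ depth c by rewrite expn_gt0.
  rewrite expnS /W in leY *.
  move: (N.+1 ^ depth c) (kost c) K_gt0 leY => X kc X0 leY.
  have -> : size (asgn_code x (Cst 0)) = 3 by [].
  have Ece : size ce = 5 by []. have Ei : size inc = 6 by [].
  rewrite Ece Ei in leY *.
  nia.
- move=> /= /and3P[we w1 w2] pc s m Hs sm.
  move=> /code_at_cat[He /code_at_cons[Hj /code_at_cat[H1]]].
  rewrite size_compile => H; have [Hk H2] := @code_at_cat p _ (jump _) _ H.
  set K1 := N.+1 ^ _; have K1_gt0 : 0 < K1 by rewrite expn_gt0.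
  have RE := reaches_exec m (compE_jump_free 0 e) He.
  have [v _] := exec_compE 0 sm we; have := sim_exec_compE 0 sm we.
  move: v RE; set m1 := exec m _ => v RE sm1.
  have := reaches_trans RE (reaches_jz m1 Hj); rewrite v.
  have leK1 : kost c1 * N.+1 ^ depth c1 <= kost c1 * K1.
    by rewrite leq_mul2l leq_pexp2l ?leq_maxl ?orbT.
  have leK2 : kost c2 * N.+1 ^ depth c2 <= kost c2 * K1.
    by rewrite leq_mul2l leq_pexp2l ?leq_maxr ?orbT.
  case: eqP => [e0|en0] RJ.
    have [m2 sm2 R2] := IH2 w2 _ _ _ Hs sm1 H2.
    exists m2 => //; rewrite !addnA; apply: reaches_le (reaches_trans RJ R2).
    nia.
  have [m2 sm2 R2] := IH1 w1 _ _ _ Hs sm1 H1.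
  exists (upd m2 (tmp 0) 0).
    by move=> j i ltj; rewrite /upd addr_tmp // sm2.
  have R3 := reaches_jump m2 Hk.
  rewrite !addnA; apply: reaches_le (reaches_trans RJ (reaches_trans R2 R3)).
  nia.
- move=> /= /andP[w1 w2] pc s m Hs sm /code_at_cat[].
  rewrite size_compile => H1 H2.
  have [m1 sm1 R1] := IH1 w1 _ _ _ Hs sm H1.
  have Hs1 y : y < 3 -> eval c1 s 0 y <= N by move=> lty; rewrite eval_readonly ?Hs.
  have [m2 sm2 R2] := IH2 w2 _ _ _ Hs1 sm1 H2.
  exists m2 => //; rewrite addnA; apply: reaches_le (reaches_trans R1 R2).
  rewrite mulnDl leq_add // leq_mul2l leq_pexp2l ?orbT //.
    exact: leq_maxl.
  exact: leq_maxr.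
- move=> /= /and4P[_ ltj wa wb] pc s m _ sm Hc.
  exists (exec m (put_code j a b)); first exact: sim_put.
  rewrite muln1; apply: reaches_exec => //.
  by rewrite !all_cat !compE_jump_free.
- move=> /= /andP[_ we] pc s m _ sm Hc; exists (exec m (asgn_code r e)).
    exact: sim_asgn.
  rewrite muln1; apply: reaches_exec => //.
  by rewrite all_cat compE_jump_free.
- by move=> /= _ pc s m _ sm _; exists m; rewrite ?addn0; last exact: reaches_refl.
Qed.

(** * The algorithm and its parts *)

(* Variables are named [r...] and arrays [a...]. For a vertex [u] standing for a
   module [V], [aAl] and [aQ] hold [a] and [q], and [m s] is entry [u * n + u + s]
   of [aM], whose rows have length [n + 1]; [aOff] holds [u * n], there being no
   multiplication. *)
Notation rN := 0 (only parsing).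
Notation rN1 := 1 (only parsing).
Notation rNm := 2 (only parsing).
Notation rK := 3 (only parsing).
Notation rU := 4 (only parsing).
Notation rV := 5 (only parsing).
Notation rW := 6 (only parsing).
Notation rAcc := 7 (only parsing).
Notation rBu := 8 (only parsing).
Notation rBv := 9 (only parsing).
Notation rX := 10 (only parsing).
Notation rY := 11 (only parsing).
Notation rS := 12 (only parsing).
Notation rT := 13 (only parsing).
Notation rRes := 14 (only parsing).
Notation rR := 15 (only parsing).
Notation aA := 1 (only parsing).
Notation aD := 2 (only parsing).
Notation aAct := 3 (only parsing).
Notation aAl := 4 (only parsing).
Notation aQ := 5 (only parsing).
Notation aM := 6 (only parsing).
Notation aTmp := 7 (only parsing).
Notation aOff := 8 (only parsing).

(** Under truncated subtraction this is the absolute difference, which on bits is the bit of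
    inequality. *)
Definition neqE a b := Plus (Minus a b) (Minus b a).
Definition minE a b := Minus a (Minus a b).
Definition maxE a b := Plus a (Minus b a).
Definition getA u v := Get aA (Plus (Get aOff u) v).
Definition getD u v := Get aD (Plus (Get aOff u) v).
Definition idxM u s := Plus (Plus (Get aOff u) u) s.
Definition getM u s := Get aM (idxM u s).

Definition offset_loop :=
  For rU rN (Seq (Put aOff (Var rU) (Var rAcc)) (Asgn rAcc (Plus (Var rAcc) (Var rN)))).

Definition offsets := Seq (Asgn rAcc (Cst 0)) offset_loop.

(** [n + 1] plays the role of infinity, in accordance with [spec1]. *)
Definition init_leaf :=
  Seq (Put aAct (Var rU) (Cst 1)) (Seq (Put aAl (Var rU) (Cst 1))
  (Seq (Put aQ (Var rU) (Cst 1))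
  (Seq (For rS rN1 (Put aM (idxM (Var rU) (Var rS)) (Var rN1)))
       (Put aM (idxM (Var rU) (Cst 1)) (Cst 0))))).

Definition init_leaves := For rU rN init_leaf.

Definition dist_cell :=
  For rW rN (Asgn rAcc (Plus (Var rAcc)
    (neqE (getA (Var rU) (Var rW)) (getA (Var rV) (Var rW))))).

Definition dist_row :=
  For rV rN (Seq (Asgn rAcc (Cst 0))
    (Seq dist_cell
         (Put aD (Plus (Get aOff (Var rU)) (Var rV)) (Var rAcc)))).

Definition distances := For rU rN dist_row.

(** A conjunction is tested as the vanishing of a sum of truncated differences. Without an early
    exit, a later hit overwrites an earlier one. *)
Definition scan_row :=
  For rV rN
    (If (Plus (Plus (Minus (Cst 1) (Get aAct (Var rU)))
                    (Minus (Cst 1) (Get aAct (Var rV))))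
              (Plus (Minus (Cst 1) (neqE (Var rU) (Var rV)))
                    (Minus (getD (Var rU) (Var rV))
                           (Plus (getA (Var rU) (Var rV)) (getA (Var rU) (Var rV))))))
        Skip (Seq (Asgn rBu (Var rU)) (Asgn rBv (Var rV)))).

Definition scan := For rU rN scan_row.

Definition update_row :=
  For rV rN (Put aD (Plus (Get aOff (Var rU)) (Var rV))
    (Minus (getD (Var rU) (Var rV))
           (neqE (getA (Var rU) (Var rBv)) (getA (Var rV) (Var rBv))))).

Definition update := For rU rN update_row.

Definition join_table :=
  For rS rN1 (Put aM (idxM (Var rBu) (Var rS))
    (maxE (Cst 1) (minE (getM (Var rBu) (Var rS)) (getM (Var rBv) (Var rS))))).

Definition join_code :=
  Seq join_table
  (Seq (If (Minus (Get aAl (Var rBu)) (Get aAl (Var rBv))) Skip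
        (If (Minus (Get aAl (Var rBv)) (Get aAl (Var rBu)))
            (Seq (Put aQ (Var rBu) (Get aQ (Var rBv)))
                 (Put aAl (Var rBu) (Get aAl (Var rBv))))
            (Put aQ (Var rBu) (Cst 0))))
       (Put aM (idxM (Var rBu) (Get aAl (Var rBu))) (Cst 0))).

(** [rS + rT] may reach [2 n]; this is harmless, as the row [aTmp] is unbounded and its entries
    beyond [n] are never copied back. *)
Definition convolve_cell :=
  Seq (Asgn rX (getM (Var rBu) (Var rS)))
  (Seq (Asgn rY (getM (Var rBv) (Var rT)))
  (Seq (If (Var rX) (Asgn rX (Plus (Var rX) (Var rT))) Skip)
  (Seq (If (Var rY) (Asgn rY (Plus (Var rY) (Var rS))) Skip)
       (Put aTmp (Plus (Var rS) (Var rT))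
          (minE (Get aTmp (Plus (Var rS) (Var rT))) (maxE (Var rX) (Var rY))))))).

Definition convolve_row := For rT rN1 convolve_cell.

Definition convolve := For rS rN1 convolve_row.

Definition clear_tmp := For rS rN1 (Put aTmp (Var rS) (Var rN1)).
Definition copy_tmp := For rS rN1 (Put aM (idxM (Var rBu) (Var rS)) (Get aTmp (Var rS))).

(** [aQ] is updated before [aAl] because it depends on the old independence numbers. *)
Definition union_code :=
  Seq clear_tmp (Seq convolve (Seq copy_tmp
  (Seq (Put aQ (Var rBu) (minE (Plus (Get aQ (Var rBu)) (Get aAl (Var rBv)))
                               (Plus (Get aQ (Var rBv)) (Get aAl (Var rBu)))))
       (Put aAl (Var rBu) (Plus (Get aAl (Var rBu)) (Get aAl (Var rBv))))))).

Definition round :=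
  Seq scan (Seq (Put aAct (Var rBv) (Cst 0)) (Seq update
    (If (getA (Var rBu) (Var rBv)) join_code union_code))).

Definition verdict_loop :=
  For rS rN1
    (If (Plus (Plus (Minus (Var rK) (Var rS))
                    (Minus (Cst 1) (neqE (Var rS) (Get aAl (Var rBu)))))
              (Minus (getM (Var rBu) (Var rS)) (Var rK)))
        Skip (Asgn rRes (Cst 0))).

(** Later assignments override earlier ones: a bound above the independence number makes the answer
    yes whatever the tables say, and so does [n = 0], where no module exists. *)
Definition verdict :=
  Seq (Asgn rRes (Cst 1))
  (Seq (If (Minus (Var rK) (Get aQ (Var rBu))) (Asgn rRes (Cst 0)) Skip)
  (Seq verdict_loop
  (Seq (If (Minus (Var rK) (Get aAl (Var rBu))) (Asgn rRes (Cst 1)) Skip)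
       (If (Var rN) Skip (Asgn rRes (Cst 1)))))).

(** The value 0 of [rBu] is the answer for [n = 1], where no round takes place and vertex 0 is the
    last module. *)
Definition main :=
  Seq offsets (Seq init_leaves (Seq distances
  (Seq (Asgn rBu (Cst 0)) (Seq (For rR rNm round) verdict)))).

Lemma wf_main : wf main. Proof. by vm_compute. Qed.
Lemma depth_main : depth main = 3. Proof. by vm_compute. Qed.

(** * Loop rules and the correctness of the initialisation *)

Definition agree c (s s' : state) := forall j a, ~~ writes c j a -> s' j a = s j a.

(** The frame [agree] comes along with the invariant, which then has to mention only what the loop
    changes. The last premise covers the final assignment to the counter. *)
Lemma eval_For (P : nat -> state -> Prop) x y c s :
  P 0 s ->
  (forall i s', i < s 0 y -> agree (For x y c) s s' -> P i s' ->
     P i.+1 (eval c (supd s' 0 x i))) ->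
  (forall s', P (s 0 y) s' -> P (s 0 y) (supd s' 0 x (s 0 y))) ->
  P (s 0 y) (eval (For x y c) s).
Proof.
move=> P0 PS Pend /=; apply: Pend.
pose Q i s' := agree (For x y c) s s' /\ P i s'.
suff [] : Q (s 0 y) (iteri (s 0 y) (fun i s' => eval c (supd s' 0 x i)) s) by [].
apply: iteri_ind => [|i s' lti [F Ps']]; first by split.
split; last exact: PS.
move=> j a nw; have := nw; rewrite /= negb_or => /andP[nx w].
by rewrite eval_frame // /supd (negPf nx) F.
Qed.

(* The loop rewrites the cells of row [j] in the region [R i] at iteration [i];
   [g] gives the final contents as a function of the address. *)
Lemma for_update x y c j s (R : nat -> nat -> bool) (g : nat -> nat) : 0 < j ->
  (forall i s', i < s 0 y -> agree (For x y c) s s' ->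
     (forall a, s' j a = if has (R^~ a) (iota 0 i) then g a else s j a) ->
     forall a, eval c (supd s' 0 x i) j a = if R i a then g a else s' j a) ->
  forall a, eval (For x y c) s j a = if has (R^~ a) (iota 0 (s 0 y)) then g a else s j a.
Proof.
move=> j0 H.
pose P i s' := forall a, s' j a = if has (R^~ a) (iota 0 i) then g a else s j a.
apply: (eval_For (P := P)) => // [i s' lti F Ps' a|s' Ps' a].
  rewrite (H i s') // [s' j a]Ps' -[in iota 0 i.+1]addn1 iotaD has_cat add0n /= orbF.
  by case: (R i a); case: has.
by rewrite /supd gtn_eqF //; apply: Ps'.
Qed.

Lemma has_row n u a : has (fun v => a == u * n + v) (iota 0 n) =
  (0 < n) && (a %/ n == u).
Proof.
apply/hasP/andP => [[v]|[n0 /eqP e]].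
  by rewrite mem_iota add0n => /= ltv /eqP->; rewrite divnMDl ?divn_small ?addn0; lia.
exists (a %% n); first by rewrite mem_iota ltn_mod.
by rewrite -e -divn_eq.
Qed.

Lemma has_base b N a : has (fun i => a == b + i) (iota 0 N) = (b <= a < b + N).
Proof.
apply/hasP/idP => [[v]|H]; first by rewrite mem_iota => + /eqP->; lia.
exists (a - b); rewrite ?mem_iota; lia.
Qed.

Lemma has_all_rows n a : has (fun u => (0 < n) && (a %/ n == u)) (iota 0 n) = (a < n * n).
Proof.
apply/hasP/idP => [[u]|H].
  by rewrite mem_iota => /= ltu /andP[n0 /eqP e]; rewrite -ltn_divLR // e.
have n0 : 0 < n by case: n H.
by exists (a %/ n); rewrite ?mem_iota ?n0 ?eqxx //= add0n ltn_divLR.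
Qed.

Lemma offsetsP s i : i < s 0 rN -> eval offsets s aOff i = i * s 0 rN.
Proof.
have -> : eval offsets s = eval offset_loop (supd s 0 rAcc 0) by [].
set s1 := supd _ _ _ _; rewrite [s 0 rN]/(s1 0 rN); move: i.
pose P i s' := s' 0 rAcc = i * s1 0 rN /\ forall a, a < i -> s' aOff a = a * s1 0 rN.
suff [_ //] : P (s1 0 rN) (eval offset_loop s1).
apply: eval_For => // i s' lti F [acc offs]; split.
  by rewrite [LHS]/(s' 0 rAcc + s' 0 rN) acc F // mulSn addnC.
move=> a; rewrite ltnS leq_eqVlt /= /supd /=.
by case: eqP => [->|_ /= /offs//].
Qed.

Lemma init_leafP s u n : s 0 rU = u -> s 0 rN1 = n.+1 -> s aOff u = u * n ->
  let s' := eval init_leaf s in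
  [/\ forall a, s' aAct a = if a == u then 1 else s aAct a,
      forall a, s' aAl a = if a == u then 1 else s aAl a,
      forall a, s' aQ a = if a == u then 1 else s aQ a &
      forall a, s' aM a = if a == u * n + u + 1 then 0 else
        if u * n + u <= a < u * n + u + n.+1 then n.+1 else s aM a].
Proof.
move=> eu en eo.
set s1 := eval (Seq (Put aAct (Var rU) (Cst 1)) (Seq (Put aAl (Var rU) (Cst 1))
   (Put aQ (Var rU) (Cst 1)))) s.
set L := For rS rN1 (Put aM (idxM (Var rU) (Var rS)) (Var rN1)).
have E3 : eval init_leaf s = eval (Put aM (idxM (Var rU) (Cst 1)) (Cst 0)) (eval L s1) by [].
have e1 : s1 0 rN1 = n.+1 by exact: en.
have e2 : s1 0 rU = u by exact: eu.
have fr j a : ~~ writes L j a -> eval L s1 j a = s1 j a by apply: eval_frame.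
have M a : eval L s1 aM a = if u * n + u <= a < u * n + u + n.+1 then n.+1 else s aM a.
  rewrite (@for_update _ _ _ _ _ (fun i a => a == u * n + u + i) (fun=> n.+1)) //.
    by rewrite e1 has_base.
  move=> i s' lti F _ b; rewrite [LHS]/= /supd /=.
  by rewrite !(F 0) // !(F aOff) // e1 e2 /s1 /= /supd /= eo.
move=> s'; rewrite /s' E3; move: (eval L s1) fr M => s2 fr M.
split=> a; rewrite /= /supd /=.
- by rewrite fr // /s1 /= /supd /= eu.
- by rewrite fr // /s1 /= /supd /= eu.
- by rewrite fr // /s1 /= /supd /= eu.
rewrite M !fr // e2.
by rewrite /s1 /= /supd /= eo.
Qed.

Lemma idxM_lt n u i t : t <= n -> u < i -> u * n + u + t < i * n + i.
Proof. nia. Qed.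

Lemma idxM_neq n u v t t' : u != v -> t <= n -> t' <= n ->
  (u * n + u + t == v * n + v + t') = false.
Proof.
move=> nuv tn tn'; apply/eqP; case: (ltngtP u v) nuv => // lt _ e.
  by have := idxM_lt tn lt; rewrite e; lia.
by have := idxM_lt tn' lt; rewrite -e; lia.
Qed.

Lemma init_leavesP s n : s 0 rN = n -> s 0 rN1 = n.+1 ->
  (forall u, u < n -> s aOff u = u * n) ->
  let s' := eval init_leaves s in forall u, u < n ->
  [/\ s' aAct u = 1, s' aAl u = 1, s' aQ u = 1, s' aM (u * n + u + 1) = 0 &
      forall t, t <= n -> t != 1 -> s' aM (u * n + u + t) = n.+1].
Proof.
move=> en en1 eo s'; rewrite {}/s'.
pose P i (s' : state) := forall u, u < i ->
  [/\ s' aAct u = 1, s' aAl u = 1, s' aQ u = 1, s' aM (u * n + u + 1) = 0 &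
      forall t, t <= n -> t != 1 -> s' aM (u * n + u + t) = n.+1].
suff : P (s 0 rN) (eval init_leaves s) by rewrite en.
apply: eval_For => // i s' lti F Ps' u; rewrite ltnS => leui.
rewrite en in lti.
have [] := @init_leafP (supd s' 0 rU i) i n erefl.
- by rewrite /supd /= F.
- by rewrite /supd /= F // eo.
move=> M3 M4 M5 M; have [->|nui] := eqVneq u i.
  split; rewrite ?M3 ?M4 ?M5 ?M ?eqxx // => t tn nt.
  by rewrite M eqn_add2l (negPf nt) leq_addr ltn_add2l ltnS tn.
have ltu : u < i by rewrite ltn_neqAle nui.
have old t : t <= n -> eval init_leaf (supd s' 0 rU i) aM (u * n + u + t) = s' aM (u * n + u + t).
  move=> tn; have lt_ui := idxM_lt tn ltu.
  rewrite M leqNgt lt_ui /= ltn_eqF //; exact: ltn_addr.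
have [H3 H4 H5 H6 H7] := Ps' u ltu.
split; rewrite ?M3 ?M4 ?M5 ?(negPf nui) //; first by rewrite old // (leq_trans _ lti).
by move=> t tn nt; rewrite old // H7.
Qed.

(** * Row distances and the search for twins *)

Section Distances.
Variables (n : nat) (e : nat -> nat -> bool).
Let dst u v := \sum_(w < n) (e u w != e v w).

Definition has_adj (s : state) :=
  [/\ s 0 rN = n, forall u, u < n -> s aOff u = u * n &
      forall u v, u < n -> v < n -> s aA (u * n + v) = e u v].

Lemma neq_bits (b c : bool) : (b - c) + (c - b) = (b != c).
Proof. by case: b c => [] []. Qed.

Lemma dist_cellP s u v : has_adj s -> s 0 rU = u -> s 0 rV = v -> u < n -> v < n ->
  eval dist_cell s 0 rAcc = s 0 rAcc + dst u v.
Proof.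
move=> [en eo eA] eu ev ltu ltv.
pose P i (s' : state) := s' 0 rAcc = s 0 rAcc + \sum_(w < i) (e u w != e v w).
suff : P (s 0 rN) (eval dist_cell s) by rewrite en.
apply: eval_For => [|i s' lti F Ps'|//]; first by rewrite /P big_ord0 addn0.
rewrite en in lti; rewrite /P big_ord_recr addnA -Ps' /= /supd /=.
rewrite !(F 0 rU) // !(F 0 rV) // !(F aOff) // !(F aA) // eu ev !eo // !eA //.
by rewrite neq_bits.
Qed.

Lemma has_adj_frame c s s' : ~~ writes c 0 rN -> (forall u, ~~ writes c aOff u) ->
  (forall a, ~~ writes c aA a) -> agree c s s' -> has_adj s -> has_adj s'.
Proof.
move=> w0 w1 w2 F [en eo eA]; split=> [|u ltu|u v ltu ltv]; rewrite F ?w0 ?w1 ?w2 //.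
  exact: eo.
exact: eA.
Qed.

Lemma agree_eval c s : agree c s (eval c s).
Proof. by move=> j a; apply: eval_frame. Qed.

Lemma divn_idx u v : v < n -> (u * n + v) %/ n = u.
Proof. by move=> lt; rewrite divnMDl ?divn_small ?addn0 // (leq_ltn_trans _ lt). Qed.

Lemma modn_idx u v : v < n -> (u * n + v) %% n = v.
Proof. by move=> lt; rewrite modnMDl modn_small. Qed.

Lemma dist_rowP s u a : has_adj s -> s 0 rU = u -> u < n ->
  eval dist_row s aD a =
    if (0 < n) && (a %/ n == u) then dst (a %/ n) (a %% n) else s aD a.
Proof.
move=> Hs eu ltu; have [en _ _] := Hs.
rewrite (@for_update _ _ _ _ _ (fun v a => a == u * n + v)
  (fun a => dst (a %/ n) (a %% n))) // ?en ?has_row //.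
move=> v s' ltv F _ b.
set s1 := supd (supd s' 0 rV v) 0 rAcc 0.
have Hs1 : has_adj s1 by have : has_adj s' by apply: has_adj_frame F Hs.
have eu1 : s1 0 rU = u by rewrite /s1 /supd /= F.
have eo : s aOff u = u * n by case: Hs => _ ->.
have := dist_cellP Hs1 eu1 erefl ltu ltv; rewrite add0n.
set s2 := eval dist_cell s1 => acc.
rewrite [LHS]/(supd s2 aD (s2 aOff (s2 0 rU) + s2 0 rV) (s2 0 rAcc) aD b) acc.
rewrite /s2 !(@eval_frame dist_cell) // eu1 /s1 /supd /= (F aOff) // eo.
by case: eqP => // ->; rewrite divn_idx ?modn_idx.
Qed.

Lemma distancesP s u v : has_adj s -> u < n -> v < n ->
  eval distances s aD (u * n + v) = dst u v.
Proof.
move=> Hs ltu ltv; have [en _ _] := Hs.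
rewrite (@for_update _ _ _ _ _ (fun u a => (0 < n) && (a %/ n == u))
  (fun a => dst (a %/ n) (a %% n))) //.
  rewrite en has_all_rows divn_idx ?modn_idx //.
  by rewrite [_ < _](_ : _ = true) //; nia.
move=> i s' lti F _ b; rewrite en in lti.
by apply: dist_rowP => //; have : has_adj s' by apply: has_adj_frame F Hs.
Qed.

Lemma update_rowP s u w d a : has_adj s -> s 0 rU = u -> u < n -> s 0 rBv = w -> w < n ->
  (forall a, a %/ n = u -> s aD a = d a) ->
  eval update_row s aD a =
    if (0 < n) && (a %/ n == u) then d a - (e (a %/ n) w != e (a %% n) w) else s aD a.
Proof.
move=> Hs eu ltu ew ltw Hd; have [en eo eA] := Hs.
rewrite (@for_update _ _ _ _ _ (fun v a => a == u * n + v)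
  (fun a => d a - (e (a %/ n) w != e (a %% n) w))) // ?en ?has_row //.
move=> v s' ltv F Hs' b.
rewrite [LHS]/= /supd /= !(F 0 rU) // !(F 0 rBv) // !(F aOff) // !(F aA) //.
rewrite eu ew !eo // !eA // neq_bits.
case: eqP => // ->; rewrite divn_idx ?modn_idx // Hs'.
(* No earlier iteration has touched this cell, so the difference is subtracted once, from the old
   value. *)
case: hasP => [[v' ]|_]; last by rewrite Hd ?divn_idx.
by rewrite mem_iota => lt /eqP/addnI ev; rewrite -ev ltnn in lt.
Qed.

Lemma updateP s w u v : has_adj s -> s 0 rBv = w -> w < n -> u < n -> v < n ->
  eval update s aD (u * n + v) = s aD (u * n + v) - (e u w != e v w).
Proof.
move=> Hs ew ltw ltu ltv; have [en _ _] := Hs.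
rewrite (@for_update _ _ _ _ _ (fun u a => (0 < n) && (a %/ n == u))
  (fun a => s aD a - (e (a %/ n) w != e (a %% n) w))) //.
  rewrite en has_all_rows divn_idx ?modn_idx //.
  by rewrite [_ < _](_ : _ = true) //; nia.
move=> i s' lti F Hs' b; rewrite en in lti.
apply: update_rowP => //; first by have : has_adj s' by apply: has_adj_frame F Hs.
  by rewrite /supd /= F.
move=> a ea; rewrite /supd /= Hs'.
case: hasP => // -[i']; rewrite mem_iota => lt /andP[_ /eqP ei].
by rewrite -ei ea ltnn in lt.
Qed.

Definition twin_cells (s : state) u v :=
  [&& 0 < s aAct u, 0 < s aAct v, u != v & s aD (u * n + v) <= e u v + e u v].

Definition found (s s' : state) :=
  [&& s' 0 rBu < n, s' 0 rBv < n & twin_cells s (s' 0 rBu) (s' 0 rBv)].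

Lemma twin_test (a b u v d : nat) (c : bool) :
  ((1 - a + (1 - b) + (1 - (u - v + (v - u)) + (d - (c + c)))) == 0) =
  [&& 0 < a, 0 < b, u != v & d <= c + c].
Proof. by case: c; lia. Qed.

(** A hit from an earlier row is either kept or replaced by another hit, hence the alternative
    [found s s]. *)
Lemma scan_rowP s u : has_adj s -> s 0 rU = u -> u < n ->
  (found s s \/ exists2 v, v < n & twin_cells s u v) -> found s (eval scan_row s).
Proof.
move=> [en eo eA] eu ltu.
pose P i (s' : state) := (found s s \/ exists2 v, v < i & twin_cells s u v) -> found s s'.
suff : P (s 0 rN) (eval scan_row s) by rewrite en.
apply: eval_For => // [[//|[]//]|v s' ltv F Ps'].
rewrite en in ltv.
rewrite /P [eval _ _]/= /supd /=.
rewrite !(F 0 rU) // !(F aAct) // !(F aOff) // !(F aA) // !(F aD) // eu eo // eA //.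
rewrite twin_test -/(twin_cells s u v); case: ifP => [tw _|tw H].
  by rewrite /found /= ltu ltv tw.
rewrite /found /=; apply: Ps'; case: H => [|[v' ltv' tw']]; first by left.
right; exists v' => //; rewrite ltn_neqAle -ltnS ltv' andbT.
by apply: contraFneq tw => <-.
Qed.

Lemma scanP s u v : has_adj s -> u < n -> v < n -> twin_cells s u v ->
  found s (eval scan s).
Proof.
move=> Hs ltu ltv tw; have [en _ _] := Hs.
pose P i (s' : state) := u < i -> found s s'.
suff : P (s 0 rN) (eval scan s) by apply; rewrite en.
apply: eval_For => // i s' lti F Ps'.
rewrite /P ltnS leq_eqVlt => H; rewrite en in lti.
have Hs' : has_adj (supd s' 0 rU i) by have : has_adj s' by apply: has_adj_frame F Hs.
have fE s2 : found (supd s' 0 rU i) s2 = found s s2.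
  by rewrite /found /twin_cells /supd /= !(F aAct) // !(F aD).
rewrite -fE; apply: scan_rowP => //; rewrite fE.
case/orP: H => [/eqP<-|/Ps' H]; last by left.
by right; exists v; rewrite // /twin_cells /supd /= !(F aAct) // !(F aD).
Qed.
End Distances.

(** * The tables of joins and unions *)

Section Merge.
Variables (n : nat) (s : state) (u v : nat).
Hypotheses (en : s 0 rN1 = n.+1) (eu : s 0 rBu = u) (ev : s 0 rBv = v) (nuv : u != v)
  (ou : s aOff u = u * n) (ov : s aOff v = v * n).

Lemma row_disjoint w t : w != u -> t <= n ->
  (u * n + u <= w * n + w + t < u * n + u + n.+1) = false.
Proof.
move=> nwu tn; apply/negP => /andP[le]; rewrite -(subnKC le) ltn_add2l ltnS => lt.
by have := idxM_neq nwu tn lt; rewrite subnKC // eqxx.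
Qed.

Lemma join_tableP a : eval join_table s aM a =
  if u * n + u <= a < u * n + u + n.+1
  then maxn 1 (minn (s aM a) (s aM (v * n + v + (a - (u * n + u))))) else s aM a.
Proof.
rewrite (@for_update _ _ _ _ _ (fun i a => a == u * n + u + i) (fun a =>
  maxn 1 (minn (s aM a) (s aM (v * n + v + (a - (u * n + u))))))) //.
  by rewrite has_base en.
move=> i s' lti F Hs' b; rewrite en ltnS in lti.
rewrite [LHS]/= /supd /= !(F 0 rBu) // !(F 0 rBv) // !(F aOff) // eu ev ou ov.
case: eqP => // ->; rewrite addKn maxnE minnE !Hs' !has_base ltnn andbF.
case: ifP => // /andP[le lt].
have := row_disjoint (w := v) (t := i); rewrite eq_sym nuv le => /(_ isT lti) /= H.
by suff: false by []; rewrite -H (leq_trans lt) // leq_add2l leqW.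
Qed.

Lemma join_codeP : s aAl u <= n -> s aAl v <= n -> let s' := eval join_code s in
  [/\ forall w, s' aAl w = if w == u then maxn (s aAl u) (s aAl v) else s aAl w,
      forall w, s' aQ w = if w == u then
         if s aAl v < s aAl u then s aQ u else if s aAl u < s aAl v then s aQ v else 0
         else s aQ w,
      forall t, t <= n -> s' aM (u * n + u + t) =
        if t == maxn (s aAl u) (s aAl v) then 0
        else maxn 1 (minn (s aM (u * n + u + t)) (s aM (v * n + v + t))) &
      forall w t, w != u -> t <= n -> s' aM (w * n + w + t) = s aM (w * n + w + t)].
Proof.
move=> au av s'.
set c2 := If (Minus (Get aAl (Var rBu)) (Get aAl (Var rBv))) Skip
        (If (Minus (Get aAl (Var rBv)) (Get aAl (Var rBu)))
            (Seq (Put aQ (Var rBu) (Get aQ (Var rBv)))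
                 (Put aAl (Var rBu) (Get aAl (Var rBv))))
            (Put aQ (Var rBu) (Cst 0))).
pose s1 := eval join_table s; pose s2 := eval c2 s1.
have E : s' = supd s2 aM (s2 aOff (s2 0 rBu) + s2 0 rBu + s2 aAl (s2 0 rBu)) 0 by [].
have F1 j a : ~~ writes join_table j a -> s1 j a = s j a by apply: eval_frame.
have F2 j a : ~~ writes c2 j a -> s2 j a = s1 j a by apply: eval_frame.
have M1 a : s1 aM a = if u * n + u <= a < u * n + u + n.+1
  then maxn 1 (minn (s aM a) (s aM (v * n + v + (a - (u * n + u))))) else s aM a.
  exact: join_tableP.
have [A2 Q2] : (forall w, s2 aAl w = if w == u then maxn (s aAl u) (s aAl v) else s aAl w) /\
   (forall w, s2 aQ w = if w == u then
         if s aAl v < s aAl u then s aQ u else if s aAl u < s aAl v then s aQ v else 0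
         else s aQ w).
  rewrite /s2 /= !(F1 0 rBu) // !(F1 0 rBv) // !(F1 aAl) // eu ev !subn_eq0.
  case: (ltngtP (s aAl u) (s aAl v)) => lt; split=> w; rewrite /supd /= ?F1 // ?eu ?ev;
    by case: (w =P u) => [e|_]; rewrite ?e.
rewrite {}E; move: F2 A2 Q2; move: s2 => s2 F2 A2 Q2; split.
- by move=> w; rewrite /supd /= A2.
- by move=> w; rewrite /supd /= Q2.
- move=> t tn; rewrite /supd /= !(F2 0 rBu) // !(F1 0 rBu) // !(F2 aOff) // !(F1 aOff) //.
  rewrite eu ou eqn_add2l A2 eqxx; case: eqP => // _.
  by rewrite F2 // M1 leq_addr ltn_add2l ltnS tn addKn.
- move=> w t nwu tn; rewrite /supd /= !(F2 0 rBu) // !(F1 0 rBu) // !(F2 aOff) //.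
  rewrite !(F1 aOff) // eu ou A2 eqxx idxM_neq // ?geq_max ?au //.
  by rewrite F2 // M1 row_disjoint.
Qed.

Lemma clear_tmpP a : a <= n -> eval clear_tmp s aTmp a = n.+1.
Proof.
move=> an; rewrite (@for_update _ _ _ _ _ (fun i a => a == 0 + i) (fun=> n.+1)) //.
  by rewrite has_base en /= ltnS an.
by move=> i s' lti F _ b; rewrite [LHS]/= /supd /= !(F 0 rN1) // en.
Qed.

Lemma copy_tmpP s' a : s' 0 rN1 = n.+1 -> s' 0 rBu = u -> s' aOff u = u * n ->
  eval copy_tmp s' aM a =
  if u * n + u <= a < u * n + u + n.+1 then s' aTmp (a - (u * n + u)) else s' aM a.
Proof.
move=> en' eu' ou'.
rewrite (@for_update _ _ _ _ _ (fun i a => a == u * n + u + i)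
  (fun a => s' aTmp (a - (u * n + u)))) //; first by rewrite has_base en'.
move=> i s'' lti F Hs' b.
rewrite [LHS]/= /supd /= !(F 0 rBu) // !(F aOff) // !(F aTmp) // eu' ou'.
by case: eqP => // ->; rewrite addKn.
Qed.

(** The adjoint of truncated subtraction: [x <= l - t] holds for every [l] if [x = 0], and means
    [x + t <= l] otherwise. *)
Definition shift x t := if x == 0 then 0 else x + t.

Lemma shift_le x t l : (shift x t <= l) = (x <= l - t).
Proof. by rewrite /shift; case: eqP => [->|nx] //; lia. Qed.

Definition same_rows (s' : state) := [/\ s' 0 rN1 = n.+1, s' 0 rBu = u, s' 0 rBv = v,
  s' aOff u = u * n /\ s' aOff v = v * n & forall a, s' aM a = s aM a].

Lemma same_rows_agree c s' s'' : ~~ writes c 0 rN1 -> ~~ writes c 0 rBu ->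
  ~~ writes c 0 rBv -> (forall a, ~~ writes c aOff a) -> (forall a, ~~ writes c aM a) ->
  agree c s' s'' -> same_rows s' -> same_rows s''.
Proof.
move=> w1 w2 w3 w4 w5 F [H1 H2 H3 [H4 H5] H6]; split; rewrite ?F //.
by move=> a; rewrite F // H6.
Qed.

Lemma convolve_cellP s' i j a : same_rows s' -> s' 0 rS = i -> s' 0 rT = j ->
  eval convolve_cell s' aTmp a =
    if a == i + j then
      minn (s' aTmp a) (maxn (shift (s aM (u * n + u + i)) j) (shift (s aM (v * n + v + j)) i))
    else s' aTmp a.
Proof.
move=> [H1 H2 H3 [H4 H5] H6] ei ej.
rewrite /= /supd /= H2 H3 H4 H5 ei ej !H6 /shift maxnE minnE.
by case: (s aM _) => [|x] /=; case: (s aM _) => [|y] /=; rewrite ?ei ?ej;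
  case: eqP => // ->.
Qed.

Definition pair_ok a l s1 s2 := [&& s1 + s2 == a, s2 <= n,
  s aM (u * n + u + s1) <= l - s2 & s aM (v * n + v + s2) <= l - s1].

(** [C] is the set of pairs treated so far. Describing an entry by the levels above it turns minimum
    and maximum into disjunction and conjunction, in the format of [stuck_spec]; the initial value
    [n + 1] lies below no level [l <= n]. *)
Definition tmp_inv (C : nat -> nat -> bool) (s' : state) := forall a l, a <= n -> l <= n ->
  (s' aTmp a <= l) <-> (exists s1 s2, C s1 s2 && pair_ok a l s1 s2).

Lemma eq_tmp_inv C C' s' : (forall s1 s2, s2 <= n -> C s1 s2 = C' s1 s2) ->
  tmp_inv C s' -> tmp_inv C' s'.
Proof.
move=> CC' H a l an ln; rewrite (H a l an ln); split=> -[s1 [s2 /andP[c ok]]];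
  exists s1, s2; rewrite ok andbT; case/and4P: ok => _ le _ _.
  by rewrite -CC'.
by rewrite CC'.
Qed.

Lemma convolve_rowP s' i : same_rows s' -> s' 0 rS = i -> i <= n ->
  tmp_inv (fun s1 _ => s1 < i) s' -> tmp_inv (fun s1 _ => s1 < i.+1) (eval convolve_row s').
Proof.
move=> H ei lei T; have [H1 H2 H3 [H4 H5] H6] := H.
(* The pairs treated so far are those lexicographically before [(i, j)]. *)
pose P j (s'' : state) := tmp_inv (fun s1 s2 => (s1 < i) || (s1 == i) && (s2 < j)) s''.
have : P (s' 0 rN1) (eval convolve_row s').
  apply: eval_For => // [|j s'' ltj F Ps''].
    by apply: eq_tmp_inv T => s1 s2 _; rewrite andbF orbF.
  rewrite H1 ltnS in ltj.
  have Hs : same_rows (supd s'' 0 rT j).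
    by have : same_rows s'' by apply: same_rows_agree F H.
  have ei'' : s'' 0 rS = i by rewrite F.
  move=> a l an ln.
  have -> : (eval convolve_cell (supd s'' 0 rT j) aTmp a <= l) =
      (s'' aTmp a <= l) || pair_ok a l i j.
    rewrite (convolve_cellP a Hs ei'' erefl).
    rewrite /pair_ok ltj eq_sym; case: eqP => [_|_] /=; last by rewrite orbF.
    by rewrite geq_min geq_max !shift_le.
  split.
    case/orP => [/(Ps'' _ _ an ln)[s1 [s2 /andP[c ok]]]|ok].
      exists s1, s2; rewrite ok andbT; case/orP: c => [->//|/andP[-> lt]].
      by rewrite ltnS (ltnW lt) /= orbT.
    by exists i, j; rewrite ok eqxx ltnSn orbT.
  case=> s1 [s2 /andP[c ok]]; have [e|ne] := boolP ((s1 == i) && (s2 == j)).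
    by case/andP: e ok => /eqP-> /eqP-> ->; rewrite orbT.
  apply/orP; left; apply/(Ps'' _ _ an ln); exists s1, s2; rewrite ok andbT.
  case/orP: c => [->//|/andP[e1 lt]]; rewrite e1 /= in ne *.
  by rewrite [s2 < j]ltn_neqAle ne (lt : s2 <= j) orbT.
apply: eq_tmp_inv => s1 s2 le; rewrite H1 ltnS le andbT ltnS [RHS]leq_eqVlt.
by rewrite orbC.
Qed.

Lemma convolveP s' : same_rows s' -> (forall a, a <= n -> s' aTmp a = n.+1) ->
  tmp_inv (fun s1 _ => s1 <= n) (eval convolve s').
Proof.
move=> H T; have [H1 H2 H3 [H4 H5] H6] := H.
pose P i (s'' : state) := tmp_inv (fun s1 _ => s1 < i) s''.
have : P (s' 0 rN1) (eval convolve s').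
  apply: eval_For => // [a l an ln|i s'' lti F Ps''].
    rewrite T //; split; first by move=> lt; have := leq_trans lt ln; rewrite ltnn.
    by case=> s1 [s2 /andP[]].
  rewrite H1 ltnS in lti.
  apply: convolve_rowP => //.
  by have : same_rows s'' by apply: same_rows_agree F H.
by rewrite /P H1; apply: eq_tmp_inv.
Qed.

Lemma union_codeP : let s' := eval union_code s in
  [/\ forall w, s' aAl w = if w == u then s aAl u + s aAl v else s aAl w,
      forall w, s' aQ w = if w == u then
         minn (s aQ u + s aAl v) (s aQ v + s aAl u) else s aQ w,
      forall t l, t <= n -> l <= n -> (s' aM (u * n + u + t) <= l) <->
        exists s1 s2, (s1 <= n) && pair_ok t l s1 s2 &
      forall w t, w != u -> t <= n -> s' aM (w * n + w + t) = s aM (w * n + w + t)].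
Proof.
move=> s'.
pose s1 := eval clear_tmp s; pose s2 := eval convolve s1.
pose s3 := eval copy_tmp s2.
set c4 := Seq (Put aQ (Var rBu) (minE (Plus (Get aQ (Var rBu)) (Get aAl (Var rBv)))
                               (Plus (Get aQ (Var rBv)) (Get aAl (Var rBu)))))
       (Put aAl (Var rBu) (Plus (Get aAl (Var rBu)) (Get aAl (Var rBv)))).
have E : s' = eval c4 s3 by [].
have F1 j a : ~~ writes clear_tmp j a -> s1 j a = s j a by apply: eval_frame.
have F2 j a : ~~ writes convolve j a -> s2 j a = s1 j a by apply: eval_frame.
have F3 j a : ~~ writes copy_tmp j a -> s3 j a = s2 j a by apply: eval_frame.
have H1 : same_rows s1 by split; rewrite ?F1 // => a; rewrite F1.
have H2 : same_rows s2 by apply: same_rows_agree H1; last exact: agree_eval.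
have T2 : tmp_inv (fun s1 _ => s1 <= n) s2.
  by apply: convolveP => // a an; apply: clear_tmpP.
have [K1 K2 K3 [K4 K5] K6] := H2.
have M3 a : s3 aM a =
  if u * n + u <= a < u * n + u + n.+1 then s2 aTmp (a - (u * n + u)) else s2 aM a.
  exact: copy_tmpP.
have E4 : s3 0 rBu = u by rewrite F3.
have E5 : s3 0 rBv = v by rewrite F3.
have AQ j a : (j == aAl) || (j == aQ) -> s3 j a = s j a.
  by case/orP => /eqP->; rewrite F3 // F2 // F1.
rewrite {}E; split=> [w|w|t l tn ln|w t nwu tn].
- by rewrite /= /supd /= E4 E5 !AQ.
- by rewrite /= /supd /= E4 E5 !AQ // minnE.
- have -> : eval c4 s3 aM (u * n + u + t) = s3 aM (u * n + u + t) by [].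
  rewrite M3 leq_addr ltn_add2l ltnS tn addKn.
  exact: T2.
- have -> : eval c4 s3 aM (w * n + w + t) = s3 aM (w * n + w + t) by [].
  by rewrite M3 row_disjoint.
Qed.
End Merge.

(** * Correctness of the algorithm *)

Lemma verdict_loopP s n k u : s 0 rN1 = n.+1 -> s 0 rK = k -> s 0 rBu = u ->
  s aOff u = u * n ->
  eval verdict_loop s 0 rRes =
    if all (fun t => (k <= t) ==> (t != s aAl u) ==> (k < s aM (u * n + u + t))) (iota 0 n.+1)
    then s 0 rRes else 0.
Proof.
move=> en ek eu eo; set c := fun t => _.
pose P i (s' : state) := s' 0 rRes = if all c (iota 0 i) then s 0 rRes else 0.
suff : P (s 0 rN1) (eval verdict_loop s) by rewrite en.
apply: eval_For => // i s' lti F Ps'.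
rewrite /P -[in iota 0 i.+1]addn1 iotaD all_cat add0n /= andbT.
rewrite /supd /= !(F 0 rK) // !(F 0 rBu) // !(F aAl) // !(F aOff) // !(F aM) // ek eu eo.
have -> : (k - i + (1 - (i - s aAl u + (s aAl u - i))) + (s aM (u * n + u + i) - k) == 0)
  = ~~ c i by rewrite /c; lia.
by case: (c i); rewrite ?andbF //= andbT.
Qed.

Lemma verdictP s n k u : s 0 rN = n -> s 0 rN1 = n.+1 -> s 0 rK = k -> s 0 rBu = u ->
  s aOff u = u * n ->
  eval verdict s 0 rRes = [|| n == 0, s aAl u < k | (k <= s aQ u) &&
    [forall t : 'I_n.+1, (k <= t) ==> (t != s aAl u :> nat) ==> (k < s aM (u * n + u + t))]].
Proof.
move=> en en1 ek eu eo.
pose s1 := eval (Seq (Asgn rRes (Cst 1))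
  (If (Minus (Var rK) (Get aQ (Var rBu))) (Asgn rRes (Cst 0)) Skip)) s.
set c3 := Seq (If (Minus (Var rK) (Get aAl (Var rBu))) (Asgn rRes (Cst 1)) Skip)
       (If (Var rN) Skip (Asgn rRes (Cst 1))).
have -> : eval verdict s = eval c3 (eval verdict_loop s1) by [].
have F j a : (j != 0) || (a != rRes) -> s1 j a = s j a.
  move=> H; apply: (@eval_frame (Seq _ _)) => /=.
  by case: (j =P 0) H => //= _ /negPf->.
have R1 : s1 0 rRes = (k <= s aQ u).
  rewrite /s1 /= /supd /= ek eu subn_eq0; by case: leqP.
have := @verdict_loopP s1 n k u.
rewrite (F 0 rN1) // (F 0 rK) // (F 0 rBu) // (F aOff) // (F aAl) // => /(_ en1 ek eu eo).
set b := all _ _; rewrite R1 => R2.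
have -> : [forall t : 'I_n.+1, (k <= t) ==> (t != s aAl u :> nat) ==>
   (k < s aM (u * n + u + t))] = b.
  apply/forallP/allP => [H t|H t]; last first.
    by have := H t; rewrite mem_iota add0n ltn_ord (F aM) // => /(_ isT).
  by rewrite mem_iota /= add0n => lt; rewrite (F aM) //; apply: (H (Ordinal lt)).
have G j a : (j != 0) || ((a != rRes) && (a != rS)) -> eval verdict_loop s1 j a = s j a.
  move=> H; rewrite eval_frame ?F //.
    by case: (j =P 0) H => //= _ /andP[].
  by move: H => /=; case: (j == 0) => //= /andP[/negPf-> /negPf->].
move: (eval verdict_loop s1) G R2 => s2 G R2.
rewrite /= !G // ek eu subn_eq0 ltnNge.
case: (leqP k (s aAl u)) => /= _.
  rewrite G // en; case: eqP => //= _.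
  by rewrite R2; case: (b); rewrite ?andbT ?andbF.
by rewrite /supd /= G // en; case: eqP => //=; rewrite orbT.
Qed.

Lemma verdict0 s : s 0 rN = 0 -> eval verdict s 0 rRes = 1.
Proof.
move=> e0.
set c := Seq (Asgn rRes (Cst 1))
  (Seq (If (Minus (Var rK) (Get aQ (Var rBu))) (Asgn rRes (Cst 0)) Skip)
  (Seq verdict_loop (If (Minus (Var rK) (Get aAl (Var rBu))) (Asgn rRes (Cst 1)) Skip))).
have -> : eval verdict s = eval (If (Var rN) Skip (Asgn rRes (Cst 1))) (eval c s) by [].
have : eval c s 0 rN = 0 by rewrite eval_frame.
by move: (eval c s) => s1 /= ->.
Qed.

Section Correctness.
Variables (n : nat) (E : rel 'I_n) (k : nat).
Hypotheses (Esym : symmetric E) (Eirr : irreflexive E) (P4 : cograph E).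
Implicit Types (S : {set 'I_n}) (Vf : 'I_n -> {set 'I_n}) (s : state).

Lemma adjbE (u v : 'I_n) : adjb E u v = E u v.
Proof. by rewrite /adjb !valK. Qed.

(** The modules of active vertices partition the vertex set, [x != y] expressing disjointness, and
    adjacency between two modules can be read off from their representatives. *)
Definition decomp S Vf := [/\ forall u, u \in S -> u \in Vf u,
  forall x, exists2 u, u \in S & x \in Vf u &
  forall u v x y, u \in S -> v \in S -> u != v -> x \in Vf u -> y \in Vf v ->
    x != y /\ E x y = E u v].

Definition merged Vf (u v : 'I_n) := fun w => if w == u then Vf u :|: Vf v else Vf w.

(** Twins see every other representative alike, so the union of their modules is again homogeneous
    towards each other module. *)
Lemma decomp_merge S Vf u v : decomp S Vf -> twins E S u v ->
  decomp (S :\ v) (merged Vf u v).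
Proof.
move=> [inV cov hom] [uS vS nuv tw]; split.
- move=> w; rewrite /merged !inE => /andP[_ wS].
  by case: eqP => [->|_]; rewrite ?inE inV.
- move=> x; have [w wS xw] := cov x; rewrite /merged.
  have [ewv|nwv] := eqVneq w v.
    by exists u; rewrite ?inE ?nuv ?uS // eqxx inE -ewv xw orbT.
  exists w; first by rewrite !inE nwv.
  by case: eqP => [<-|//]; rewrite inE xw.
have one w x y : w \in S -> w != u -> w != v -> x \in Vf u :|: Vf v -> y \in Vf w ->
    x != y /\ E x y = E u w.
  move=> wS nwu nwv; rewrite inE => /orP[]xV yw; first by apply: hom; rewrite // eq_sym.
  by rewrite tw //; apply: hom; rewrite // eq_sym.
move=> a b x y; rewrite !inE => /andP[nav aS] /andP[nbv bS] nab.
rewrite /merged; case: eqP => [ea|/eqP nau]; case: eqP => [eb|/eqP nbu].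
- by rewrite ea eb eqxx in nab.
- by rewrite ea => xV yV; apply: one.
- rewrite eb => xV yV; have [nyx e] := one a y x aS nau nav yV xV.
  by rewrite eq_sym nyx Esym e Esym.
- exact: hom.
Qed.

Record inv s S Vf : Prop := Inv {
  inv_regs : [/\ s 0 rN1 = n.+1, s 0 rNm = n.-1 & s 0 rK = k];
  inv_adj : has_adj n (adjb E) s;
  inv_act : forall u : 'I_n, s aAct u = (u \in S);
  inv_dist : forall u v : 'I_n, s aD (u * n + v) = #|[set w in S | E u w != E v w]|;
  inv_spec : forall u : 'I_n, u \in S -> 0 < s aAl u /\
    spec E (Vf u) (s aAl u) (s aQ u) (fun t => s aM (u * n + u + t));
  inv_decomp : decomp S Vf }.

Lemma sum_adjb (u v : 'I_n) : \sum_(w < n) (adjb E u w != adjb E v w) =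
  #|[set w in setT | E u w != E v w]|.
Proof.
rewrite -sum1_card [RHS]big_mkcond; apply: eq_bigr => w _.
by rewrite !adjbE !inE /=; case: (_ != _).
Qed.

Definition prelude := Seq offsets (Seq init_leaves (Seq distances (Asgn rBu (Cst 0)))).

Lemma preludeP s : s 0 rN = n -> s 0 rN1 = n.+1 -> s 0 rNm = n.-1 -> s 0 rK = k ->
  (forall u v, u < n -> v < n -> s aA (u * n + v) = adjb E u v) ->
  inv (eval prelude s) setT (fun u => [set u]).
Proof.
move=> e0 e1 e2 e3 eA.
pose s1 := eval offsets s; pose s2 := eval init_leaves s1; pose s3 := eval distances s2.
have -> : eval prelude s = supd s3 0 rBu 0 by [].
have F1 j a : ~~ writes offsets j a -> s1 j a = s j a by apply: eval_frame.
have F2 j a : ~~ writes init_leaves j a -> s2 j a = s1 j a by apply: eval_frame.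
have F3 j a : ~~ writes distances j a -> s3 j a = s2 j a by apply: eval_frame.
have O1 u : u < n -> s1 aOff u = u * n by move=> lt; rewrite /s1 offsetsP e0.
have H1 : has_adj n (adjb E) s1 by split=> [|//|u v lu lv]; rewrite F1 // eA.
have e10 : s1 0 rN = n by rewrite F1.
have e11 : s1 0 rN1 = n.+1 by rewrite F1.
have H2 : has_adj n (adjb E) s2 by apply: has_adj_frame (@agree_eval init_leaves s1) H1.
have H3 : has_adj n (adjb E) s3 by apply: has_adj_frame (@agree_eval distances s2) H2.
have L := init_leavesP e10 e11 O1.
split.
- by rewrite /supd /= !F3 // !F2 // !F1.
- by have := H3.
- move=> u; rewrite inE /supd /= F3 //.
  by case: (L u (ltn_ord u)).
- move=> u v; rewrite -sum_adjb /supd /=; exact: distancesP.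
- move=> u _; have [_ a1 q1 m1 m2] := L u (ltn_ord u).
  have -> : supd s3 0 rBu 0 aAl u = 1 by rewrite /supd /= F3.
  have -> : supd s3 0 rBu 0 aQ u = 1 by rewrite /supd /= F3.
  split=> //.
  apply: (@spec_ext _ _ _ _ _ (fun t => if t == 1 then 0 else n.+1)).
    move=> t tn; rewrite /supd /= F3 //; case: eqP => [->//|/eqP nt].
    by rewrite [RHS]m2.
  by apply: spec1 => // t /negPf->.
- split=> [u _|x|u v x y _ _ nuv]; first by rewrite inE.
    by exists x; rewrite ?inE.
  by move=> /set1P-> /set1P->.
Qed.

Lemma roundP s S Vf : inv s S Vf -> 1 < #|S| ->
  exists u v, let s' := eval round s in
  [/\ inv s' (S :\ v) (merged Vf u v), v \in S, u \in S :\ v & s' 0 rBu = u].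
Proof.
move=> [[e1 e2 e3] adj act dst sp dc] S1.
have [u0 [v0 tw0]] := cograph_twins Esym Eirr P4 S1.
have cells (u v : 'I_n) : twin_cells n (adjb E) s u v <-> twins E S u v.
  rewrite /twin_cells !act dst adjbE !lt0b; split.
    by case/and4P => uS vS nuv; rewrite twins_count.
  move=> tw; have [uS vS nuv _] := tw.
  by rewrite uS vS nuv /=; apply/twins_count.
(* The existence of some twins guarantees a hit; the pair actually found may be a different one. *)
have := scanP adj (ltn_ord u0) (ltn_ord v0) (proj2 (cells _ _) tw0).
pose s1 := eval scan s; rewrite -/s1 => /and3P[lu lv].
have [u eu] : exists u : 'I_n, s1 0 rBu = u by exists (Ordinal lu).
have [v ev] : exists v : 'I_n, s1 0 rBv = v by exists (Ordinal lv).
rewrite eu ev => /cells tw; have [uS vS nuv _] := tw.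
exists u, v => s'.
pose s2 := supd s1 aAct v 0; pose s3 := eval update s2.
pose cm := If (getA (Var rBu) (Var rBv)) join_code union_code.
have Es' : s' = eval cm s3 by rewrite /s3 /s2 -ev.
have F1 j a : ~~ writes scan j a -> s1 j a = s j a by apply: eval_frame.
have F3 j a : ~~ writes update j a -> s3 j a = s2 j a by apply: eval_frame.
have F4 j a : ~~ writes cm j a -> s' j a = s3 j a by rewrite Es'; apply: eval_frame.
have A1 : has_adj n (adjb E) s1 by apply: has_adj_frame (@agree_eval scan s) adj.
have A2 : has_adj n (adjb E) s2 by have := A1.
have A3 : has_adj n (adjb E) s3 by apply: has_adj_frame (@agree_eval update s2) A2.
have A4 : has_adj n (adjb E) s' by rewrite Es'; apply: has_adj_frame (@agree_eval cm s3) A3.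
have vals j a : j \in [:: aAl; aQ; aM] -> s3 j a = s j a.
  by rewrite !inE => /or3P[]/eqP->; rewrite F3 // -[s2 _ _]/(s1 _ _) F1.
have r3 a : a \in [:: rN1; rNm; rK] -> s3 0 a = s 0 a.
  by rewrite !inE => /or3P[]/eqP->; rewrite F3 // -[s2 _ _]/(s1 _ _) F1.
have eu3 : s3 0 rBu = u by rewrite F3.
have ev3 : s3 0 rBv = v by rewrite F3.
have ou3 : s3 aOff u = u * n by case: A3 => _ ->.
have ov3 : s3 aOff v = v * n by case: A3 => _ ->.
have nuv' : u != v :> nat by [].
have e13 : s3 0 rN1 = n.+1 by rewrite r3.
have [a1 sp1] := sp u uS; have [a2 sp2] := sp v vS.
have [inV cov hom] := dc.
have ev_cm : s' = if E u v then eval join_code s3 else eval union_code s3.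
  have -> : s' = if s3 aA (s3 aOff (s3 0 rBu) + s3 0 rBv) == 0 then eval union_code s3
                 else eval join_code s3 by [].
  rewrite eu3 ev3 ou3; case: A3 => _ _ -> //.
  by rewrite adjbE; case: (E u v).
have [M1 M2] : (0 < s' aAl u /\ spec E (Vf u :|: Vf v) (s' aAl u) (s' aQ u)
       (fun t => s' aM (u * n + u + t))) /\
    (forall w : 'I_n, w != u -> [/\ s' aAl w = s aAl w, s' aQ w = s aQ w &
       forall t, t <= n -> s' aM (w * n + w + t) = s aM (w * n + w + t)]).
  rewrite ev_cm; case: ifP => Euv.
    have [] := join_codeP e13 eu3 ev3 nuv' ou3 ov3; rewrite ?vals //.
    - by case: sp1 => /alpha_le_n.
    - by case: sp2 => /alpha_le_n.
    move=> J1 J2 J3 J4; split; last first.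
      move=> w nw; rewrite J1 J2 (negPf (nw : w != u :> nat)) ?vals //.
      by split=> // t tn; rewrite J4 ?vals.
    rewrite J1 J2 eqxx; split; first by rewrite leq_max a1.
    apply: spec_join sp1 sp2 _ => //.
      by move=> x y xV yV; have [_ ->] := hom u v x y uS vS nuv xV yV.
    by move=> t tn; rewrite J3 // ?vals.
  have [] := union_codeP e13 eu3 ev3 nuv' ou3 ov3; rewrite ?vals //.
  move=> J1 J2 J3 J4; split; last first.
    move=> w nw; rewrite J1 J2 (negPf (nw : w != u :> nat)) ?vals //.
    by split=> // t tn; rewrite J4 ?vals.
  rewrite J1 J2 eqxx ?vals //; split; first by rewrite addn_gt0 a1.
  apply: spec_union sp1 sp2 _ => //.
    split.
      apply/pred0P => x; apply/negP => /andP[/= xV yV].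
      by have [] := hom u v x x uS vS nuv xV yV; rewrite eqxx.
    by move=> x y xV yV; have [_ ->] := hom u v x y uS vS nuv xV yV; rewrite Euv.
  move=> t l lt tn; rewrite J3 ?(leq_trans lt) //; split.
    case=> t1 [t2 /andP[_ /and4P[/eqP et _ h1 h2]]]; exists t1, t2.
    by rewrite ?vals in h1 h2.
  case=> t1 [t2 [et h1 h2]]; exists t1, t2; rewrite /pair_ok ?vals // h1 h2 et eqxx.
  by rewrite !andbT -et in tn *; rewrite !(leq_trans _ tn) ?leq_addr ?leq_addl.
split=> //.
- split.
  + by rewrite !F4 // !r3.
  + by [].
  + move=> w; rewrite F4 // F3 // /s2 /supd /= !inE.
    rewrite (_ : (w == v :> nat) = (w == v)) //; case: (w == v) => //=.
    by rewrite F1 // act.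
  + move=> w x; rewrite F4 // /s3.
    rewrite (updateP A2 ev) // !adjbE (F1 aD _ isT : s2 aD _ = s aD _) dst.
    rewrite (cardsD1 v) inE vS /= addKn; congr #|pred_of_set _|.
    by apply/setP => y; rewrite !inE andbA.
  + move=> w; rewrite !inE => /andP[nwv wS]; rewrite /merged.
    case: eqP => [->//|/eqP nwu].
    have [-> -> M] := M2 w nwu; have [aw spw] := sp w wS; split=> //.
    by apply: spec_ext spw => t tn; rewrite M.
  + exact: decomp_merge.
- by rewrite !inE nuv.
- by rewrite F4.
Qed.

Lemma TAR_connected_n0 (K : int) : n = 0 -> TAR_connected E K.
Proof.
move=> n0; have eI (I J : {set 'I_n}) : I = J.
  by apply/setP => x; have := ltn_ord x; rewrite [X in _ < X]n0.
by apply/forallP => I; apply/forallP => J; apply/implyP => _; rewrite (eI I J) connect0.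
Qed.

Lemma mainP s (K : int) : clamp K = k -> s 0 rN = n -> s 0 rN1 = n.+1 ->
  s 0 rNm = n.-1 -> s 0 rK = k ->
  (forall u v, u < n -> v < n -> s aA (u * n + v) = adjb E u v) ->
  eval main s 0 rRes = TAR_connected E K.
Proof.
move=> eK e0 e1 e2 e3 eA.
pose rl := For rR rNm round.
have -> : eval main s = eval verdict (eval rl (eval prelude s)) by [].
have I1 := preludeP e0 e1 e2 e3 eA.
have b1 : eval prelude s 0 rBu = 0 by [].
move: (eval prelude s) I1 b1 => s1 I1 b1.
have en1 : s1 0 rNm = n.-1 by case: I1 => -[].
(* The register [rBu] is tracked so that at the end it names the only active vertex. *)
pose P i (s' : state) := exists S Vf, [/\ inv s' S Vf, #|S| = n - i &
  0 < n -> exists2 u : 'I_n, u \in S & s' 0 rBu = u].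
have : P (s1 0 rNm) (eval rl s1).
  apply: eval_For => [|i s' lti F [S [Vf [I' cS _]]]|s' [S [Vf [I' cS bu]]]].
  - exists setT, (fun u => [set u]); split; rewrite ?cardsT ?card_ord ?subn0 // => n0.
    by exists (Ordinal n0); rewrite ?inE.
  - rewrite en1 in lti.
    have I2 : inv (supd s' 0 rR i) S Vf by case: I'.
    have S1 : 1 < #|S| by rewrite cS; clear -lti; lia.
    have [u [v [I3 vS uS bu]]] := roundP I2 S1.
    exists (S :\ v), (merged Vf u v); split => //; last by exists u.
    move: cS; rewrite (cardsD1 v S) vS; clear -lti => cS; lia.
  - by exists S, Vf; split => //; case: I'.
move: (eval rl s1) => s2 [S [Vf [I2 cS bu]]].
have [[r1 r2 r3] [r0 off _] _ _ sp [_ cov _]] := I2.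
have [n0|n_gt0] := posnP n; first by rewrite TAR_connected_n0 // verdict0 // r0.
have [u uS eu] := bu n_gt0.
rewrite (@verdictP s2 n k u) ?off // gtn_eqF //=.
have /cards1P[w eS] : #|S| == 1 by rewrite cS en1; apply/eqP; clear -n_gt0; lia.
have euw : u = w by apply/set1P; rewrite -eS.
(* The modules cover all vertices and only one of them is left. *)
have VT : Vf u = setT.
  by apply/setP => x; rewrite inE; have [v] := cov x; rewrite eS => /set1P->; rewrite euw.
have [_] := sp u uS; rewrite VT => spT.
by rewrite (TAR_connected_spec K spT) eK.
Qed.
End Correctness.

(** * Loading the input *)

(** The literal jump targets in the loading code are absolute, [boot] being placed at address 0. *)
Definition clamp_code := [:: IJz 1 3; IConst 1 0; IJz 1 4; IConst 2 0].

(** Horner's scheme for [packed]. The last four instructions provide the constant 1, a counter, a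
    zero for unconditional jumps and a copy of [n] to count down. *)
Definition pack_code :=
  [:: IConst 3 0; IAdd 3 3 3; IAdd 3 3 4; IAdd 3 3 3; IAdd 3 3 5;
      IAdd 3 3 3; IAdd 3 3 6; IAdd 3 3 3; IAdd 3 3 7;
      IConst 4 1; IConst 5 0; IConst 6 0; IAdd 1 0 6].

Definition square_code := [:: IJz 1 21; IAdd 5 5 0; ISub 1 1 4; IJz 6 17].

Definition move_body :=
  [:: ISub 5 5 4; IConst 6 3; IAdd 6 6 5; IRead 7 6;
      IAdd 6 5 5; IAdd 6 6 6; IAdd 6 6 6; IAdd 6 6 6; IConst 1 9; IAdd 6 6 1;
      IWrite 6 7; IConst 1 0].

Definition move_code := IJz 5 35 :: move_body ++ [:: IJz 1 21].

(** Truncated subtraction of [2 ^ q - 1] is positive exactly if the leading bit is set; subtracting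
    twice from the 1 in cell 4 normalises this to a bit, which is then removed from the packed
    number. *)
Definition unpack_bit q d :=
  [:: IConst 6 (2 ^ q - 1); ISub 6 3 6; ISub 6 4 6; ISub 6 4 6; IConst 7 0; IAdd d 6 7]
  ++ nseq q (IAdd 6 6 6) ++ [:: ISub 3 3 6].

Definition set_regs :=
  [:: IConst 7 0; IConst (addr 1 0) 0; IAdd (addr 0 0) 0 7; IAdd (addr 0 1) 0 4;
      ISub (addr 0 2) 0 4; IAdd (addr 0 3) 2 7].

Definition unpack_code :=
  unpack_bit 3 (addr 1 1) ++ unpack_bit 2 (addr 1 2) ++ unpack_bit 1 (addr 1 3) ++
  unpack_bit 0 (addr 1 4) ++ set_regs.

(* Cells 3 to 7 of the input become scratch registers: cell 3 is a diagonal entry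
   of the adjacency matrix, and the bits of cells 4 to 7 are packed into it. The
   matrix is then spread out to row 1, from its last entry backwards since the
   new positions overlap the old ones. *)
Definition boot := clamp_code ++ pack_code ++ square_code ++ move_code ++ unpack_code.

Definition tar_program :=
  boot ++ compile (size boot) main ++ [:: IConst 1 0; IAdd 0 (addr 0 rRes) 1; IHalt].

Lemma idx_lt n u v : u < n -> v < n -> u * n + v < n * n.
Proof. nia. Qed.

Lemma idx_eq0 n u v : u < n -> u * n + v = 0 -> u = 0 /\ v = 0.
Proof. nia. Qed.

Lemma halted_at p pc m : nth IHalt p pc = IHalt -> halted p (pc, m).
Proof. by rewrite /halted /= => ->. Qed.

Lemma exec_cat5 m a b c d e : exec m (a ++ b ++ c ++ d ++ e) =
  exec (exec (exec (exec (exec m a) b) c) d) e.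
Proof. by rewrite !exec_cat. Qed.

Lemma exec_double m q a : exec m (nseq q (IAdd 6 6 6)) a = if a == 6 then m 6 * 2 ^ q else m a.
Proof.
elim: q m => [|q IH] m; first by rewrite muln1; case: eqP => [->|].
have -> : exec m (nseq q.+1 (IAdd 6 6 6)) = exec (upd m 6 (m 6 + m 6)) (nseq q (IAdd 6 6 6)) by [].
rewrite IH /upd eqxx.
by case: eqP => // _; rewrite expnS addnn -mul2n mulnA [2 * m 6]mulnC -mulnA.
Qed.

Lemma unpack_bitP m q d (m' := exec m (unpack_bit q d)) : 7 < d -> m 4 = 1 ->
  [/\ m' d = (2 ^ q <= m 3), m' 3 = m 3 - (2 ^ q <= m 3) * 2 ^ q &
      forall a, a \notin [:: 3; 6; 7; d] -> m' a = m a].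
Proof.
move=> ltd m4; rewrite {}/m' /unpack_bit exec_cat exec_cat.
move E1 : (exec m [:: _; _; _; _; _; _]) => m1.
have q0 : 0 < 2 ^ q by rewrite expn_gt0.
have nd x : x <= 7 -> (x == d) = false by move=> le; apply/eqP; lia.
have bitE : m 4 - (m 4 - (m 3 - (2 ^ q - 1))) = (2 ^ q <= m 3).
  by rewrite m4; case: leqP => /=; lia.
have Hm1 x : m1 x = if x == d then nat_of_bool (2 ^ q <= m 3) else
    if x == 7 then 0 else if x == 6 then nat_of_bool (2 ^ q <= m 3) else m x.
  rewrite -E1 /exec /= /exec1 /= /upd /= bitE addn0.
  by case: (x == d); case: (x == 7); case: (x == 6).
have D a : exec (exec m1 (nseq q (IAdd 6 6 6))) [:: ISub 3 3 6] a =
    if a == 3 then m1 3 - m1 6 * 2 ^ q else if a == 6 then m1 6 * 2 ^ q else m1 a.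
  rewrite -(exec_double m1 q a).
  have -> : m1 3 = exec m1 (nseq q (IAdd 6 6 6)) 3 by rewrite exec_double.
  by have -> : m1 6 * 2 ^ q = exec m1 (nseq q (IAdd 6 6 6)) 6 by rewrite exec_double.
split=> [||a]; first by rewrite D !(eq_sym d) (nd 3) // (nd 6) // Hm1 eqxx.
  by rewrite D /= !Hm1 (nd 3) // (nd 6).
rewrite !inE !negb_or => /and4P[/negPf n3 /negPf n6 /negPf n7 /negPf nda].
by rewrite D n3 n6 Hm1 n6 n7 nda.
Qed.

(** * Correctness of the loading code *)

Section Boot.
Variables (n : nat) (E : rel 'I_n) (k : int).
Hypothesis Eirr : irreflexive E.
Let m0 := init_mem E k.

Lemma init_entry u v : u < n -> v < n -> m0 (3 + (u * n + v)) = adjb E u v.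
Proof.
move=> lu lv; have lt := idx_lt lu lv.
rewrite /m0 /init_mem /= !ltn_add2l lt /=.
have -> : 3 + (u * n + v) - 3 = u * n + v by rewrite addKn.
by rewrite divn_idx // modn_idx.
Qed.

Lemma init_bit j : exists b : bool, m0 (3 + j) = b.
Proof.
rewrite /m0 /init_mem /=; case: ifP => _; eexists; last exact: (erefl (nat_of_bool false)).
by [].
Qed.

Definition packed := 8 * m0 4 + 4 * m0 5 + 2 * m0 6 + m0 7.

Lemma reaches_clamp p : code_at p 0 clamp_code -> exists2 m,
  [/\ m 2 = clamp k & forall a, a != 1 -> a != 2 -> m a = m0 a] &
  reaches p (0, m0) 4 (4, m).
Proof.
move=> /code_at_cons[H0 /code_at_cons[H1 /code_at_cons[H2 /code_at_cons[H3 _]]]].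
have m01 : m0 1 = (0 <= k)%R by [].
have := reaches_jz m0 H0; rewrite m01; case kp: (0 <= k)%R => /= R0.
  exists (upd m0 1 0).
    by split=> [|a /negPf n1 _]; rewrite /upd ?n1 //= /clamp kp.
  apply: reaches_le (reaches_trans R0 (reaches_trans (reaches_const m0 H1) (reaches_jz _ H2))).
  by [].
exists (upd m0 2 0).
  by split=> [|a _ /negPf n2]; rewrite /upd ?n2 //= /clamp kp.
by apply: reaches_le (reaches_trans R0 (reaches_const m0 H3)).
Qed.

Definition regs (m : memory) i :=
  [/\ m 0 = n, m 2 = clamp k, m 3 = packed, m 4 = 1 & m 5 = i].

Lemma reaches_square p m : code_at p 17 square_code ->
  regs m 0 -> m 1 = n -> m 6 = 0 ->
  exists2 m', regs m' (n * n) /\ (forall a, 8 <= a -> m' a = m a) &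
    reaches p (17, m) (n * 4 + 1) (21, m').
Proof.
move=> /code_at_cons[Hj].
move=> /(@code_at_cat _ _ [:: IAdd 5 5 0; ISub 1 1 4] [:: IJz 6 17])[Hb /code_at_cons[Hk _]].
move=> R m1 m6.
suff loop i j m' : i + j = n -> regs m' (j * n) -> m' 1 = i -> m' 6 = 0 ->
    exists2 m'', regs m'' (n * n) /\ (forall a, 8 <= a -> m'' a = m' a) &
    reaches p (17, m') (i * 4 + 1) (21, m'').
  by apply: (loop n 0); rewrite ?addn0.
elim: i j m' => [|i' IH] j m' ij [r0 r2 r3 r4 r5] r1 r6.
  exists m'; first by split=> //; split=> //; rewrite r5 (ij : j = n).
  by have := reaches_jz m' Hj; rewrite r1.
have := reaches_jz m' Hj; rewrite r1 => R1.
have R2 := reaches_exec m' (isT : all jump_free [:: IAdd 5 5 0; ISub 1 1 4]) Hb.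
set m2 := exec m' _ in R2.
have v6 : m2 6 = 0 by rewrite /m2 /exec /= /exec1 /= /upd /=.
have := reaches_jz m2 Hk; rewrite v6 => R3.
have [] := IH j.+1 m2.
- by rewrite -ij addnS.
- split; rewrite /m2 /exec /= /exec1 /= /upd //=.
  by rewrite r5 r0 mulSn addnC.
- by rewrite /m2 /exec /= /exec1 /= /upd /= r1 r4 subn1.
- exact: v6.
move=> m3 [Rg Fr] R4; exists m3.
  split=> // a lea; rewrite Fr // /m2 /exec /= /exec1 /= /upd.
  by rewrite !gtn_eqF // (leq_trans _ lea).
rewrite mulSn -addnA.
exact: reaches_le (reaches_trans R1 (reaches_trans R2 (reaches_trans R3 R4))).
Qed.

(** Below index 5 the source is one of the scratch cells 3 to 7, so nothing is claimed about the
    copy; [unpack_code] sets these entries afterwards. *)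
Lemma exec_move m i : regs m i.+1 -> let m' := exec m move_body in
  [/\ regs m' i, m' 1 = 0 & forall a, 8 <= a -> (a = addr 1 i -> 5 <= i) ->
      m' a = if a == addr 1 i then m (3 + i) else m a].
Proof.
move=> [r0 r2 r3 r4 r5]; rewrite /move_body /exec /= /exec1 /= /upd /= r4 r5 subn1 /=.
have ei : forall x, x + x + (x + x) + (x + x + (x + x)) + (x + x + (x + x) + (x + x + (x + x))) + 9
   = addr 1 x by move=> x; rewrite /addr; lia.
rewrite !ei; have ne b : b <= 7 -> (b == addr 1 i) = false.
  by move=> le; apply/eqP; rewrite /addr; lia.
split; first by split; rewrite /= ?ne //.
  by [].
move=> a lea le5; have nb b : b <= 7 -> (a == b) = false by move=> le; apply/eqP; lia.
rewrite !(nb 1) // !(nb 5) // !(nb 6) // !(nb 7) //; case: eqP => // /le5 {}le5.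
by rewrite !gtn_eqF //; lia.
Qed.

Lemma reaches_move p m : code_at p 21 move_code -> regs m (n * n) ->
  (forall a, 8 <= a -> m a = m0 a) ->
  exists2 m', regs m' 0 /\ (forall j, 5 <= j -> j < n * n -> m' (addr 1 j) = m0 (3 + j)) &
    reaches p (21, m) (n * n * 14 + 1) (35, m').
Proof.
move=> /code_at_cons[Hj /code_at_cat[Hb /code_at_cons[Hk _]]] R Hm.
(* Cells from 8 up to [addr 1 i] are still intact; apart from the scratch cells, all sources not yet
   read lie there. *)
suff loop i m' : i <= n * n -> regs m' i ->
    (forall j, 5 <= j -> i <= j -> j < n * n -> m' (addr 1 j) = m0 (3 + j)) ->
    (forall a, 8 <= a -> a < addr 1 i -> m' a = m0 a) ->
    exists2 m'', regs m'' 0 /\ (forall j, 5 <= j -> j < n * n -> m'' (addr 1 j) = m0 (3 + j)) &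
    reaches p (21, m') (i * 14 + 1) (35, m'').
  apply: loop => // [j _|a le8 _]; last exact: Hm.
  by move=> le lt; have := leq_ltn_trans le lt; rewrite ltnn.
elim: i m' => [|i IH] m' lei Rg Hd Hs; have [r0 r2 r3 r4 r5] := Rg.
  exists m'; first by split=> // j le5 lt; apply: Hd.
  by have := reaches_jz m' Hj; rewrite r5.
have := reaches_jz m' Hj; rewrite r5 => R1.
have R2 := reaches_exec m' (isT : all jump_free move_body) Hb.
have [] := exec_move Rg; move: R2; set m2 := exec m' _ => R2 Rg2 v1 M.
have := reaches_jz m2 Hk; rewrite v1 => R3.
have [] := IH m2 (ltnW lei) Rg2.
- move=> j le5 leij lt; rewrite M; [|by rewrite /addr; lia|by rewrite /addr; lia].
  case: eqP => [e|ne].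
    have -> : j = i by move: e; rewrite /addr; lia.
    apply: Hs; last by rewrite /addr; lia.
    by move: e; rewrite /addr; lia.
  apply: Hd => //; rewrite ltn_neqAle leij andbT; apply/eqP => e; apply: ne.
  by rewrite e.
- move=> a le8 lt; rewrite M //; last by move=> e; rewrite e ltnn in lt.
  rewrite ltn_eqF //; apply: Hs => //.
  by move: lt; rewrite /addr; lia.
move=> m3 H R4; exists m3 => //; rewrite mulSn -addnA.
exact: reaches_le (reaches_trans R1 (reaches_trans R2 (reaches_trans R3 R4))).
Qed.

Lemma exec_unpack m : regs m 0 ->
  (forall j, 5 <= j -> j < n * n -> m (addr 1 j) = m0 (3 + j)) ->
  let s := fun j i => exec m unpack_code (addr j i) in
  [/\ s 0 0 = n, s 0 1 = n.+1, s 0 2 = n.-1, s 0 3 = clamp k &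
      forall u v, u < n -> v < n -> s 1 (u * n + v) = adjb E u v].
Proof.
move=> [r0 r2 r3 r4 _] Hm.
have [b4 e4] := init_bit 1; have [b5 e5] := init_bit 2.
have [b6 e6] := init_bit 3; have [b7 e7] := init_bit 4.
have L j i : 7 < addr j i by rewrite /addr -addnA.
have -> : exec m unpack_code = exec (exec (exec (exec (exec m (unpack_bit 3 (addr 1 1)))
    (unpack_bit 2 (addr 1 2))) (unpack_bit 1 (addr 1 3))) (unpack_bit 0 (addr 1 4))) set_regs.
  exact: exec_cat5.
have := unpack_bitP 3 (L 1 1) r4; move: (exec m _) => m1 [D1 T1 F1].
have := unpack_bitP 2 (L 1 2) (etrans (F1 4 isT) r4).
move: (exec m1 _) => m2 [D2 T2 F2].
have f2 : m2 4 = 1 by rewrite F2 // F1.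
have := unpack_bitP 1 (L 1 3) f2; move: (exec m2 _) => m3 [D3 T3 F3].
have f3 : m3 4 = 1 by rewrite F3.
have := unpack_bitP 0 (L 1 4) f3; move: (exec m3 _) => m4 [D4 T4 F4].
have f4 : m4 4 = 1 by rewrite F4.
have c0 : m 3 = 8 * b4 + 4 * b5 + 2 * b6 + b7 by rewrite r3 /packed e4 e5 e6 e7.
have g1 : m1 3 = 4 * b5 + 2 * b6 + b7.
  by rewrite T1 c0; case: (b4) (b5) (b6) (b7) => [] [] [] [].
have g2 : m2 3 = 2 * b6 + b7.
  by rewrite T2 g1; case: (b5) (b6) (b7) => [] [] [].
have g3 : m3 3 = b7 by rewrite T3 g2; case: (b6) (b7) => [] [].
have h1 : m4 (addr 1 1) = b4.
  by rewrite F4 // F3 // F2 // D1 c0; case: (b4) (b5) (b6) (b7) => [] [] [] [].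
have h2 : m4 (addr 1 2) = b5.
  by rewrite F4 // F3 // D2 g1; case: (b5) (b6) (b7) => [] [] [].
have h3 : m4 (addr 1 3) = b6.
  by rewrite F4 // D3 g2; case: (b6) (b7) => [] [].
have h4 : m4 (addr 1 4) = b7 by rewrite D4 g3; case: (b7).
have h5 j : 5 <= j -> m4 (addr 1 j) = m (addr 1 j).
  move=> le5; have N b : b < addr 1 5 -> (addr 1 j == b) = false.
    move=> lt; rewrite gtn_eqF // (leq_trans lt) //.
    by rewrite /addr leq_add2r leq_add2l leq_mul2l le5.
  by rewrite F4 ?F3 ?F2 ?F1 // !inE !N.
have k0 : m4 0 = n by rewrite F4 // F3 // F2 // F1.
have k2 : m4 2 = clamp k by rewrite F4 // F3 // F2 // F1.
have [V0 V1 V2 V3] : [/\ exec m4 set_regs (addr 0 0) = n, exec m4 set_regs (addr 0 1) = n.+1,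
    exec m4 set_regs (addr 0 2) = n.-1 & exec m4 set_regs (addr 0 3) = clamp k].
  by split; rewrite /exec /= /exec1 /= /upd /= ?k0 ?k2 ?f4 ?addn0 ?addn1 ?subn1.
split=> // u v lu lv.
have Z : exec m4 set_regs (addr 1 (u * n + v)) =
    if u * n + v == 0 then 0 else m4 (addr 1 (u * n + v)).
  have N i : (addr 1 (u * n + v) == addr 0 i) = false by rewrite addr_inj.
  have N7 : (addr 1 (u * n + v) == 7) = false by rewrite gtn_eqF.
  by rewrite /exec /= /exec1 /= /upd !N N7 addr_inj.
rewrite Z -init_entry //.
move: (init_entry lu lv); have := idx_lt lu lv.
have : u * n + v = 0 -> adjb E u v = false.
  move=> e0; have [u0 v0] := idx_eq0 lu e0.
  by rewrite u0 v0 /adjb; case: insub => // x; rewrite Eirr.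
(* Entry 0 is diagonal, entries 1 to 4 come from the packed bits, and the others have been moved. *)
case: (u * n + v) => [|[|[|[|[|j]]]]] Z0 lt I /=.
- by rewrite I Z0.
- by rewrite h1 -e4.
- by rewrite h2 -e5.
- by rewrite h3 -e6.
- by rewrite h4 -e7.
- by rewrite h5 // Hm.
Qed.

Lemma reaches_boot p : code_at p 0 boot -> exists2 m,
  let s := fun j i => m (addr j i) in
  [/\ s 0 0 = n, s 0 1 = n.+1, s 0 2 = n.-1, s 0 3 = clamp k &
      forall u v, u < n -> v < n -> s 1 (u * n + v) = adjb E u v] &
  reaches p (0, m0) (4 * n + 14 * (n * n) + 100) (size boot, m).
Proof.
move=> /code_at_cat[H1 /code_at_cat[H2 /code_at_cat[H3 /code_at_cat[H4 H5]]]].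
have [m1 [c2 F1] R1] := reaches_clamp H1.
have R2 := reaches_exec m1 (isT : all jump_free pack_code) H2.
set m2 := exec m1 _ in R2.
have Rg : [/\ regs m2 0, m2 1 = n & m2 6 = 0].
  rewrite /m2 /exec /= /exec1 /= /upd /=; rewrite !F1 //; split=> //; last exact: addn0.
  split=> //; rewrite /= ?F1 // /packed.
  by rewrite !add0n; lia.
have [Rg0 v1 v6] := Rg.
have [m3 [Rg3 F3] R3] := reaches_square H3 Rg0 v1 v6.
have Hm3 a : 8 <= a -> m3 a = m0 a.
  move=> lea; rewrite F3 // /m2 /exec /= /exec1 /= /upd.
  by rewrite !gtn_eqF ?(leq_trans _ lea) // F1 // gtn_eqF // (leq_trans _ lea).
have [m4 [Rg4 A4] R4] := reaches_move H4 Rg3 Hm3.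
have R5 := reaches_exec m4 (isT : all jump_free unpack_code) H5.
exists (exec m4 unpack_code); first exact: exec_unpack.
have := reaches_trans R1 (reaches_trans R2 (reaches_trans R3 (reaches_trans R4 R5))).
apply: reaches_le.
have -> : size pack_code = 13 by []. have -> : size unpack_code = 40 by [].
by lia.
Qed.
End Boot.

(** * The cubic time bound *)

Theorem theorem1 :
  exists (p : program) (C : nat),
    forall (n : nat) (E : rel 'I_n) (k : int),
      simple_graph E -> cograph E ->
      exists t : nat, t <= C * (n ^ 3 + 1) /\
        decides_within p E k (TAR_connected E k) t.
Proof.
(* Loop bounds are at most [n + 1], so the compiled code takes at most [kost main * (n + 2) ^ 3]
   steps, and [(n + 2) ^ 3 <= 27 * (n ^ 3 + 1)]. The summand 200 covers loading the input and
   fetching the result. *)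
exists tar_program, (27 * kost main + 200)%N => n E k [Esym Eirr] P4.
have H : code_at tar_program 0 tar_program by [].
have [Hb /code_at_cat[]] := code_at_cat H; rewrite add0n size_compile => Hc He.
have [m [s0 s1 s2 s3 s4] R1] := reaches_boot k Eirr Hb.
(* The initial state is read off the memory, so [sim] holds by definition. Remains of the input in
   other rows do no harm, as [mainP] assumes nothing about them. *)
set s := fun j i => m (addr j i) in s0 s1 s2 s3 s4.
have Hs y : y < 3 -> s 0 y <= n.+1.
  by case: y => [|[|[|]]] // _; rewrite /s ?s0 ?s1 ?s2 //; clear; lia.
have sm : sim s m by [].
have [m' sm' R2] := reaches_compile wf_main Hs sm Hc.
pose fin := [:: IConst 1 0; IAdd 0 (addr 0 rRes) 1].
have /(@code_at_cat _ _ fin [:: IHalt])[Hf /code_at_cons[Hh _]] := He.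
have R3 := reaches_exec m' (isT : all jump_free fin) Hf.
have [t lt rt] := reaches_trans R1 (reaches_trans R2 R3).
exists t; split.
  apply: leq_trans lt _; rewrite depth_main (_ : size fin = 2) //.
  move: (kost main) => K.
  have : n * n <= n ^ 3 by case: (n) => // x; rewrite mulnn leq_pexp2l.
  have : n <= n ^ 3 by case: (n) => // x; rewrite -{1}[x.+1]expn1 leq_pexp2l.
  have : n.+2 ^ 3 <= 27 * (n ^ 3 + 1).
    case: (n) => // x; apply: (@leq_trans ((3 * x.+1) ^ 3)); last by rewrite expnMn; lia.
    by rewrite leq_exp2r //; lia.
  move: (n * n) (n ^ 3) (n.+2 ^ 3) => A B D lD lB lA.
  have : K * D <= K * (27 * (B + 1)) by rewrite leq_mul2l lD orbT.
  lia.
rewrite /decides_within rt; split; first exact: halted_at.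
have M := @mainP n E (clamp k) Esym Eirr P4 s k erefl s0 s1 s2 s3 s4.
have Hres : exec m' fin 0 = m' (addr 0 rRes).
  by rewrite /exec /= /exec1 /= /upd /= addn0.
exact: etrans Hres (etrans (sm' 0 rRes isT) M).
Qed.
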